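(* Let $G^{\nu}$ be a wconnected $\nu$-wgraph with $2\le\nu\le\omega$ (possibly $\nu=\vec{\omega}$), let $\rho\le\nu$ be either a natural number or $\omega$ (not $\vec{\omega}$), and let $S^{\rho}$ be a $\rho$-wsection of $G^{\nu}$. Suppose that the enlargement ${}^{*}S^{\rho}$ has a hypernode (of any rank $\alpha$ with $0\le\alpha\le\rho$) that is not in the principal $\rho$-galaxy $\Gamma_{0}^{\rho}$ of ${}^{*}S^{\rho}$. Then the set of $\rho$-galaxies of ${}^{*}S^{\rho}$ is partially ordered according to the closeness of the $\rho$-galaxies to the principal $\rho$-galaxy $\Gamma^{\rho}_{0}$; that is, the relation ''$\Gamma_a^\rho=\Gamma_b^\rho$ or $\Gamma^{\rho}_a$ is closer to $\Gamma_0^{\rho}$ than is $\Gamma^{\rho}_b$'' is reflexive, antisymmetric and transitive.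
   Context: Ranks and ordinals. Ranks are the natural numbers $0,1,2,\dots$, the formal rank $\vec{\omega}$ (larger than all natural numbers and smaller than $\omega$), and $\omega$. For a rank $\rho=\omega$, ''$\rho-1$'' means $\vec{\omega}$. Ordinals are in Cantor normal form and are added by natural (Hessenberg) summation. $\mathcal{F}$ is a fixed free ultrafilter on $\mathbb{N}$. Wgraphs. A $0$-graph is $\{X^{0},B\}$, with $X^{0}$ a set of $0$-nodes and $B$ a set of branches, i.e. two-element subsets of $X^0$. A $0$-walk is an alternating sequence $\langle\dots,x_m,b_m,x_{m+1},\dots\rangle$ of $0$-nodes and branches, indexed by consecutive integers, with $b_m$ incident to $x_m$ and $x_{m+1}$, ending at a $0$-node wherever it terminates; repetitions are allowed. It is two-ended (finite), one-ended (one-way infinite) or endless (two-way infinite). A $(-1)$-tip is an end of a branch; a $0$-node embraces itself and the $(-1)$-tips of its incident branches. Recursively, for a natural number $\rho$, a $\rho$-wtip is an equivalence class of one-ended $\rho$-walks, two being equivalent if they are identical from some point on, up to a shift of indices. Partition the set of all $\rho$-wtips into nonempty subsets $T_i$; a $(\rho+1)$-wnode is a set $T_i\cup N_i$, where $N_i$ is empty or a singleton whose member (the exceptional element) is a wnode of rank at most $\rho$, and each wnode is the exceptional element of at most one wnode of higher rank. A wnode embraces itself, its elements, and everything embraced by its exceptional element. For $\rho\ge1$, a $\rho$-walk is an alternating sequence $\langle\dots,x_m,W_m,x_{m+1},W_{m+1},\dots\rangle$ indexed by consecutive integers, where the nonterminal $x_m$ are $\rho$-wnodes, a terminal element (wherever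 the sequence terminates) is a wnode of rank at most $\rho$, and each $W_m$ is a nontrivial walk of rank at most $\rho-1$ that reaches $x_m$ on its left and $x_{m+1}$ on its right (i.e. on that side it either terminates at a wnode embraced by that wnode or is infinite with its wtip embraced by that wnode), such that for each nonterminal $x_m$ at least one of $W_{m-1},W_m$ reaches $x_m$ through a $(\rho-1)$-wtip. Two-ended, one-ended and endless are as for $0$-walks. An $\vec{\omega}$-wnode is a maximal infinite chain of wnodes of strictly increasing natural-number ranks, each the exceptional element of the next; it embraces everything its members embrace. A one-ended $\vec{\omega}$-walk is a sequence $\langle x_0,W_0,x_1,W_1,\dots\rangle$ with $x_m$ a wnode of natural-number rank $\mu_m$, $\mu_0<\mu_1<\cdots$, and $W_m$ a walk of rank less than $\mu_{m+1}$ reaching $x_m$ and $x_{m+1}$, the latter through a $(\mu_{m+1}-1)$-wtip; an endless one joins two of these at their starting wnodes; $\vec{\omega}$-wtips are classes of eventually identical one-ended $\vec{\omega}$-walks (up to merging consecutive pieces). Partition the set of all $\vec{\omega}$-wtips into nonempty subsets $T_i$; an $\omega$-wnode is a set $T_i\cup N_i$, where $N_i$ is empty or a singleton whose member (the exceptional element) is a wnode of rank at most $\vec{\omega}$, and each wnode is the exceptional element of at most one wnode of higher rank; an $\omega$-wnode embraces itself, its elements, and everything embraced by its exceptional element. An $\omega$-walk is an alternating sequence $\langle\dots,x_m,W_m,x_{m+1},W_{m+1},\dots\rangle$ indexed by consecutive integers, where the nonterminal $x_m$ are $\omega$-wnodes, a terminal element (wherever the sequence terminates) is a wnode of rank at most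 $\omega$, and each $W_m$ is a nontrivial walk of rank at most $\vec{\omega}$ that reaches $x_m$ on its left and $x_{m+1}$ on its right, such that for each nonterminal $x_m$ at least one of $W_{m-1},W_m$ reaches $x_m$ through an $\vec{\omega}$-wtip; it is two-ended, one-ended or endless according to whether the sequence is finite, one-way infinite or two-way infinite. A $\nu$-wgraph is $G^{\nu}=\{X^{0},B,X^{1},\dots,X^{\nu}\}$, with $X^{\gamma}$ the set of $\gamma$-wnodes, nonempty except possibly for $\gamma=\vec{\omega}$. It is wconnected if every two wnodes are the terminal wnodes of some two-ended walk in it. Lengths and wdistance. The length $|W|$ of a two-ended $0$-walk is its number of branch traversals. For a natural number or $\omega$ as rank $\gamma$, a one-ended $\gamma$-walk has length $\omega^{\gamma+1}$ and an endless one $\omega^{\gamma+1}\cdot2$; a one-ended (endless) $\vec{\omega}$-walk has length $\omega^{\omega}$ ($\omega^{\omega}\cdot 2$). A two-ended $\gamma$-walk with $\gamma\ge1$ has length the natural sum of the lengths of its constituent walks $W_m$. A wnode is maximal if it is not embraced by a wnode of higher rank. The wdistance is $d(x,y)=\min|W|$ over two-ended walks $W$ terminating at $x$ and $y$, where a walk terminating at a wnode is also regarded as terminating at any wnode embracing it and wdistances from a nonmaximal wnode equal those from the maximal wnode embracing it; $d(x,y)=0$ if $x,y$ are embraced by the same maximal wnode. Wsections. A $\rho$-wsection $S^{\rho}$ of $G^{\nu}$ ($\rho<\nu$) is a maximal wsubgraph of the $\rho$-wgraph $\{X^{0},B,\dots,X^{\rho}\}$ that is $\rho$-wconnected: every two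 of its wnodes are joined by a two-ended $\alpha$-walk with $\alpha\le\rho$ ($\alpha<\vec{\omega}$ if $\rho=\vec{\omega}$). It consists of a set of branches together with the wnodes of rank at most $\rho$ embracing a tip having a representative in those branches. The only $\nu$-wsection is $G^{\nu}$ itself. A wsection $S^\rho$ is a $\rho$-wgraph by itself, with wdistance $d$. Enlargement. A $\gamma$-hypernode of ${}^{*}S^{\rho}$ is an equivalence class $\mathbf{x}=[x_n]$ of sequences of $\gamma$-wnodes of $S^{\rho}$, two sequences being equivalent if they agree on a set of indices in $\mathcal{F}$. A hyperbranch is a pair $\{[x_n],[y_n]\}$ of $0$-hypernodes with $\{n:\{x_n,y_n\}\text{ is a branch of }S^{\rho}\}\in\mathcal{F}$. The enlargement ${}^{*}S^{\rho}$ consists of all hypernodes of all ranks at most $\rho$ and all hyperbranches. A hypernode is standard if it is represented by a constant sequence. Galaxies. For $\rho$ a natural number or $\omega$, hypernodes $\mathbf{x}=[x_n]$ and $\mathbf{y}=[y_n]$ (of any ranks) are $\rho$-limitedly distant if there is $\mu\in\mathbb{N}$ with $\{n: d(x_n,y_n)\le\omega^{\rho}\cdot\mu\}\in\mathcal{F}$. This is an equivalence relation on hypernodes; its classes are the nodal $\rho$-galaxies, and a $\rho$-galaxy consists of the hypernodes of a nodal $\rho$-galaxy together with the hyperbranches whose $0$-hypernodes lie in it. The principal $\rho$-galaxy $\Gamma_0^{\rho}$ is the one whose hypernodes are $\rho$-limitedly distant from a standard hypernode. Closeness. For $\rho$-galaxies $\Gamma_a^{\rho},\Gamma_b^{\rho}$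 of ${}^{*}S^{\rho}$ ($\Gamma_a^\rho=\Gamma_0^\rho$ being allowed), $\Gamma_a^{\rho}$ is closer to $\Gamma_0^{\rho}$ than is $\Gamma_b^{\rho}$ if there are $\mathbf{y}=[y_n]$ in $\Gamma_a^{\rho}$ and $\mathbf{z}=[z_n]$ in $\Gamma_b^{\rho}$ such that, for some $\mathbf{x}=[x_n]$ in $\Gamma_0^{\rho}$ and every $m\in\mathbb{N}$, $\{n: d(z_n,x_n)-d(y_n,x_n)\ge\omega^{\rho}\cdot m\}\in\mathcal{F}$; here the inequality means $d(z_n,x_n)\ge d(y_n,x_n)+\omega^{\rho}\cdot m$. *)

(* Defs.v *)
From HB Require Import structures.
From mathcomp Require Import all_boot all_order all_algebra.
From mathcomp Require Import boolp classical_sets functions filter.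
From Stdlib Require Import Relation_Operators.

Set Implicit Arguments.
Unset Strict Implicit.
Unset Printing Implicit Defensive.

Import Order.TTheory GRing.Theory Num.Theory.

Local Open Scope classical_set_scope.
Local Open Scope ring_scope.

(** [Arrow] is the rank lying above all natural numbers and below omega. *)
Inductive rank : Type := Fin of nat | Arrow | Omega.

Definition rank_le (r s : rank) : bool :=
  match r, s with
  | Fin m, Fin n => (m <= n)%N
  | Fin _, _ => true
  | Arrow, Fin _ => false
  | Arrow, _ => true
  | Omega, Omega => true
  | Omega, _ => false
  end.

Definition rank_lt (r s : rank) : bool := rank_le r s && ~~ rank_le s r.

(** [rank_pred r] is [r - 1], the rank of the wtips in the wnodes of rank [r].
    It is [None] for 0-wnodes, whose (-1)-tips are the ends of their incident
    branches, and for [Arrow]-wnodes, which contain wnodes but no wtips. *)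
Definition rank_pred (r : rank) : option rank :=
  match r with
  | Fin n.+1 => Some (Fin n)
  | Omega => Some Arrow
  | _ => None
  end.

(** The lexicographically ordered pair [(a, b)] stands for omega * a + b. *)
Definition expo : Type := (nat *l nat)%type.

Definition expo_ge (a b : expo) : bool := (b <= a)%O.

(** A nonincreasing sequence e_1, ..., e_k of exponents stands for the ordinal
    omega^e_1 + ... + omega^e_k.  On such sequences the order of the ordinals
    is the lexicographic one.  The ordinals below omega^(omega^2) obtained in
    this way include the lengths of all walks of rank at most omega. *)
Record cnf := Cnf {
  cnf_exps : seqlexi expo;
  cnf_sorted : sorted expo_ge cnf_exps
}.

HB.instance Definition _ := [isSub for cnf_exps].
HB.instance Definition _ := [Choice of cnf by <:].
HB.instance Definition _ := [SubChoice_isSubOrder of cnf by <: with Order.Disp tt tt].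

Definition cnf0 : cnf := @Cnf [::] isT.

Lemma cnf_add_subproof (a b : cnf) :
  sorted expo_ge (merge expo_ge (cnf_exps a) (cnf_exps b)).
Proof.
apply: merge_sorted; [|exact: cnf_sorted..].
by move=> x y; rewrite /expo_ge le_total.
Qed.

(** Natural (Hessenberg) addition. *)
Definition cnf_add (a b : cnf) : cnf := Cnf (cnf_add_subproof a b).

Lemma cnf_mono_subproof (e : expo) (n : nat) : sorted expo_ge (nseq n e).
Proof. by case: n => //= n; elim: n => //= n ->; rewrite /expo_ge lexx. Qed.

(** omega^e * n *)
Definition cnf_mono (e : expo) (n : nat) : cnf := Cnf (cnf_mono_subproof e n).

(** The rank [r] as an exponent.  There is no omega^[Arrow]; the value at
    [Arrow] is never used. *)
Definition rank_expo (r : rank) : expo :=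
  match r with
  | Fin n => (0%N, n)
  | Arrow => (1%N, 0%N)
  | Omega => (1%N, 0%N)
  end.

(** The length of a one-ended walk of rank [r] is omega to this exponent. *)
Definition one_ended_expo (r : rank) : expo :=
  match r with
  | Fin n => (0%N, n.+1)
  | Arrow => (1%N, 0%N)
  | Omega => (1%N, 1%N)
  end.

(** The integer interval with least element [a] and greatest element [b], where
    [None] means that the interval is unbounded on that side. *)
Definition inside (a b : option int) (i : int) : bool :=
  (if a is Some l then l <= i else true) &&
  (if b is Some h then i <= h else true).

(** The raw sequences, over a set [N] of prospective wnodes, among which
    [is_walk] below selects the walks of a wgraph.  Only the wnodes [x i] with
    [inside a b i], and the constituents [W i], which lie between [x i] and
    [x (i + 1)], with [inside a b i] and [inside a b (i + 1)], are meaningful.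
    The branches of a 0-walk are determined by its 0-nodes. *)
Inductive pwalk (N : Type) : Type :=
  | Walk0 (a b : option int) (x : int -> N)
  | WalkS (r : rank) (a b : option int) (x : int -> N) (W : int -> pwalk N).

Section WalkExpressions.
Variable N : Type.
Implicit Types v w : pwalk N.

Definition wrank w := match w with Walk0 _ _ _ => Fin 0 | WalkS r _ _ _ _ => r end.
Definition wlo w := match w with Walk0 a _ _ => a | WalkS _ a _ _ _ => a end.
Definition whi w := match w with Walk0 _ b _ => b | WalkS _ _ b _ _ => b end.
Definition wnode w := match w with Walk0 _ _ x => x | WalkS _ _ _ x _ => x end.

Definition winside w := inside (wlo w) (whi w).

(** For a 0-walk, the piece between two consecutive 0-nodes is the 0-walk that
    traverses the single branch between them. *)
Definition wpiece w (i : int) : pwalk N :=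
  match w with
  | Walk0 _ _ x => Walk0 (Some i) (Some (i + 1)) x
  | WalkS _ _ _ _ W => W i
  end.

Definition two_ended w : Prop := wlo w <> None /\ whi w <> None.
Definition one_ended w : Prop := wlo w <> None /\ whi w = None.
Definition nontrivial w : Prop := exists i, winside w i /\ winside w (i + 1).

(** The same walk traversed in the opposite direction. *)
Fixpoint wrev w : pwalk N :=
  match w with
  | Walk0 a b x => Walk0 (omap -%R b) (omap -%R a) (fun i => x (- i))
  | WalkS r a b x W =>
      WalkS r (omap -%R b) (omap -%R a) (fun i => x (- i))
            (fun i => wrev (W (- i - 1)))
  end.

(** Identity of walks, up to a shift of indices at every level. *)
Inductive same_walk : pwalk N -> pwalk N -> Prop :=
  | same_walk0 a b x a' b' x' (k : int) :
      (forall i, inside a b i = inside a' b' (i + k)) ->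
      (forall i, inside a b i -> x i = x' (i + k)) ->
      same_walk (Walk0 a b x) (Walk0 a' b' x')
  | same_walkS r a b x W a' b' x' W' (k : int) :
      (forall i, inside a b i = inside a' b' (i + k)) ->
      (forall i, inside a b i -> x i = x' (i + k)) ->
      (forall i, inside a b i -> inside a b (i + 1) ->
        same_walk (W i) (W' (i + k))) ->
      same_walk (WalkS r a b x W) (WalkS r a' b' x' W').

Definition eventually_same v w : Prop :=
  exists k m : int, forall i, m <= i ->
    wnode v i = wnode w (i + k) /\ same_walk (wpiece v i) (wpiece w (i + k)).

(** A branch traversal within a walk is located by the list of the indices of
    the nested constituents containing it, followed by its index in the
    innermost 0-walk.  The lexicographic order of these lists is the order of
    traversal.  [traversed w p] is the branch traversed at [p], as an ordered
    pair of 0-nodes. *)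
Fixpoint traversed w (p : seq int) : option (N * N) :=
  match w, p with
  | Walk0 a b x, [:: i] =>
      if inside a b i && inside a b (i + 1) then Some (x i, x (i + 1)) else None
  | WalkS _ a b _ W, i :: q =>
      if inside a b i && inside a b (i + 1) then traversed (W i) q else None
  | _, _ => None
  end.

Definition traversals_from w (p : seqlexi int) : set (seqlexi int) :=
  [set q | (p <= q)%O /\ traversed w q <> None].

(** From some point on, [v] and [w] traverse the same branches in the same
    (transfinite) order. *)
Definition eventually_same_traversals v w : Prop :=
  exists (p q : seqlexi int) (f : seqlexi int -> seqlexi int),
    [/\ traversed v p <> None /\ traversed w q <> None,
        set_bij (traversals_from v p) (traversals_from w q) f,
        {in traversals_from v p &, {homo f : s t / (s < t)%O}} &
        forall s, traversals_from v p s -> traversed w (f s) = traversed v s].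

(** Equivalence of walks without end on the right.  For rank [Arrow], being
    eventually identical is only required up to merging or splitting consecutive
    constituents, which changes the bracketing of a walk into constituents but
    not the sequence of its branches. *)
Definition tip_equiv v w : Prop :=
  [/\ whi v = None, whi w = None, wrank v = wrank w &
      if wrank v is Arrow then eventually_same_traversals v w
      else eventually_same v w].

(** Of use for walks only; no two-ended walk has rank [Arrow]. *)
Fixpoint wlength w : cnf :=
  match w with
  | Walk0 (Some l) (Some h) _ => cnf_mono (rank_expo (Fin 0)) `|h - l|
  | WalkS _ (Some l) (Some h) _ W =>
      \big[cnf_add/cnf0]_(i < `|h - l|%N) wlength (W (l + i%:Z))
  | Walk0 None None _ => cnf_mono (one_ended_expo (Fin 0)) 2
  | Walk0 _ _ _ => cnf_mono (one_ended_expo (Fin 0)) 1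
  | WalkS r None None _ _ => cnf_mono (one_ended_expo r) 2
  | WalkS r _ _ _ _ => cnf_mono (one_ended_expo r) 1
  end.

Fixpoint branches_in (Bs : set (set N)) w : Prop :=
  match w with
  | Walk0 a b x =>
      forall i, inside a b i -> inside a b (i + 1) -> Bs [set x i; x (i + 1)]
  | WalkS _ a b _ W =>
      forall i, inside a b i -> inside a b (i + 1) -> branches_in Bs (W i)
  end.

End WalkExpressions.

(** Wnodes are abstract points of [N], given with their elements: [elts x] is
    the set of those elements of [x] that are wnodes (its exceptional element,
    or, for rank [Arrow], the members of the chain), and [tips x] is the set of
    those that are wtips, a wtip being a set of one-ended walks. *)
Record wgraph_data (N : Type) := WgraphData {
  gr_rank : rank;
  wnodes : set N;
  rk : N -> rank;
  branches : set (set N);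
  elts : N -> set N;
  tips : N -> set (set (pwalk N))
}.

Section Wgraphs.
Variables (N : Type) (G : wgraph_data N).
Implicit Types (x y : N) (w : pwalk N).

Definition wnode_of_rank (r : rank) : set N :=
  [set x | wnodes G x /\ rk G x = r].

(** [embraces x y]: the wnode [x] embraces the wnode [y]. *)
Definition embraces : N -> N -> Prop := clos_refl_trans_1n N (elts G).

Definition embraces_tip x (t : set (pwalk N)) : Prop :=
  exists2 y, embraces x y & tips G y t.

(** [w] either terminates on its right at a wnode embraced by [x], or is
    infinite on its right with its wtip embraced by [x]. *)
Definition reaches_right w x : Prop :=
  match whi w with
  | Some h => embraces x (wnode w h)
  | None => exists2 t, embraces_tip x t & exists2 v, t v & tip_equiv v w
  end.

Definition reaches_left w x : Prop := reaches_right (wrev w) x.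

(** From the index [c] on, the ranks of the wnodes of [w] are strictly
    increasing natural numbers, and every constituent arrives at the next wnode,
    of rank n + 1 say, through an n-wtip (which is necessarily its own right
    wtip, so that the constituent has rank n). *)
Definition arrow_from w (c : int) : Prop :=
  forall i, c <= i ->
    exists m n, [/\ rk G (wnode w i) = Fin m, rk G (wnode w (i + 1)) = Fin n.+1,
                    (m < n.+1)%N,
                    whi (wpiece w i) = None & wrank (wpiece w i) = Fin n].

Definition arrow_shape w : Prop :=
  match wlo w, whi w with
  | Some l, None => arrow_from w l
  | None, Some h => arrow_from (wrev w) (- h)
  | None, None => exists c, arrow_from w c /\ arrow_from (wrev w) (- c)
  | Some _, Some _ => False
  end.

(** The conditions specific to walks of a rank [r] >= 1 other than [Arrow]. *)
Definition ranked_shape (r : rank) w : Prop :=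
  exists2 s, rank_pred r = Some s &
    [/\ forall i, winside w i -> rank_le (rk G (wnode w i)) r,
        forall i, winside w i -> winside w (i + 1) ->
          rank_le (wrank (wpiece w i)) s &
        forall i, winside w (i - 1) -> winside w i -> winside w (i + 1) ->
          rk G (wnode w i) = r /\
          (whi (wpiece w (i - 1)) = None /\ wrank (wpiece w (i - 1)) = s \/
           wlo (wpiece w i) = None /\ wrank (wpiece w i) = s)].

Fixpoint is_walk w : Prop :=
  match w with
  | Walk0 a b x =>
      [/\ exists i, inside a b i,
          forall i, inside a b i -> wnode_of_rank (Fin 0) (x i) &
          forall i, inside a b i -> inside a b (i + 1) ->
            branches G [set x i; x (i + 1)]]
  | WalkS r a b x W =>
      [/\ rank_le r (gr_rank G),
          exists i, inside a b i,
          forall i, inside a b i -> wnodes G (x i),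
          forall i, inside a b i -> inside a b (i + 1) ->
            [/\ is_walk (W i), nontrivial (W i),
                reaches_left (W i) (x i) & reaches_right (W i) (x (i + 1))] &
          if r is Arrow then arrow_shape w else ranked_shape r w]
  end.

Definition one_ended_walk (r : rank) : set (pwalk N) :=
  [set w | [/\ is_walk w, one_ended w & wrank w = r]].

Definition is_wtip (r : rank) (t : set (pwalk N)) : Prop :=
  exists2 w, one_ended_walk r w &
    t = [set v | one_ended_walk r v /\ tip_equiv v w].

Definition is_chain (c : set N) : Prop :=
  exists s : nat -> N,
    [/\ forall i, exists n, wnode_of_rank (Fin n) (s i),
        forall i, rank_lt (rk G (s i)) (rk G (s i.+1)),
        forall i, elts G (s i.+1) (s i) &
        c = range s].

Definition is_maximal_chain (c : set N) : Prop :=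
  is_chain c /\ forall c', is_chain c' -> c `<=` c' -> c' = c.

Record is_wgraph : Prop := IsWgraph {
  wg_rank : forall x, wnodes G x -> rank_le (rk G x) (gr_rank G);
  wg_nonempty : forall r, rank_le r (gr_rank G) -> r <> Arrow ->
    exists x, wnode_of_rank r x;
  wg_branches : forall b, branches G b -> exists x y,
    [/\ wnode_of_rank (Fin 0) x, wnode_of_rank (Fin 0) y, x <> y &
        b = [set x; y]];
  wg_0nodes : forall x, wnode_of_rank (Fin 0) x ->
    elts G x = set0 /\ tips G x = set0;
  wg_elts : forall x y, wnodes G x -> elts G x y -> wnodes G y;
  wg_exceptional : forall x, wnodes G x -> rk G x <> Arrow ->
    (forall y, elts G x y -> rank_lt (rk G y) (rk G x)) /\
    (forall y y', elts G x y -> elts G x y' -> y = y');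
  wg_exceptional_inj : forall x x' y,
    wnodes G x -> rk G x <> Arrow -> wnodes G x' -> rk G x' <> Arrow ->
    elts G x y -> elts G x' y -> x = x';
  wg_tips : forall x s, wnodes G x -> rank_pred (rk G x) = Some s ->
    tips G x !=set0 /\ (forall t, tips G x t -> is_wtip s t);
  wg_tips_partition : forall r s t,
    rank_le r (gr_rank G) -> rank_pred r = Some s -> is_wtip s t ->
    exists! x, wnode_of_rank r x /\ tips G x t;
  wg_arrow : forall x, wnode_of_rank Arrow x ->
    tips G x = set0 /\ is_maximal_chain (elts G x);
  wg_arrow_all : forall c, rank_le Arrow (gr_rank G) -> is_maximal_chain c ->
    exists! x, wnode_of_rank Arrow x /\ elts G x = c
}.

(** [w] is a two-ended walk from [x] to [y], where a walk terminating at a wnode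
    also terminates at any wnode embracing it. *)
Definition joins w x y : Prop :=
  is_walk w /\
  exists l h, [/\ wlo w = Some l, whi w = Some h,
                  embraces x (wnode w l) & embraces y (wnode w h)].

Definition wconnected : Prop :=
  forall x y, wnodes G x -> wnodes G y -> exists w, joins w x y.

Definition is_maximal_wnode x : Prop :=
  wnodes G x /\
  forall y, wnodes G y -> embraces y x -> ~~ rank_lt (rk G x) (rk G y).

Definition wdist_candidates x y : set cnf :=
  [set d | exists x' y',
    [/\ is_maximal_wnode x' /\ embraces x' x,
        is_maximal_wnode y' /\ embraces y' y &
        (x' = y' /\ d = cnf0) \/ exists2 w, joins w x' y' & d = wlength w]].

(** The minimum exists whenever some walk joins the two maximal wnodes. *)
Definition wdist x y : cnf :=
  xget cnf0 [set d | wdist_candidates x y d /\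
                     forall d', wdist_candidates x y d' -> (d <= d')%O].

End Wgraphs.

(** The wsubgraph of the [r]-wgraph of the wnodes of [G] of ranks at most [r]
    that is generated by the set [Bs] of branches.  Its wtips are the wtips of
    [G] cut down to their representatives in [Bs]. *)
Definition wsubgraph (N : Type) (G : wgraph_data N) (r : rank)
    (Bs : set (set N)) : wgraph_data N :=
  let Xs := [set x | [/\ wnodes G x, rank_le (rk G x) r &
    (exists y b, [/\ embraces G x y, Bs b & b y]) \/
    (exists2 t, embraces_tip G x t & exists2 w, t w & branches_in Bs w)]] in
  {| gr_rank := r;
     wnodes := Xs;
     rk := rk G;
     branches := Bs;
     elts := fun x => elts G x `&` Xs;
     tips := fun x => [set t' | t' !=set0 /\
       exists2 t, tips G x t & t' = t `&` [set w | branches_in Bs w]] |}.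

Definition is_wsection (N : Type) (G : wgraph_data N) (r : rank)
    (S : wgraph_data N) : Prop :=
  (r = gr_rank G /\ S = G) \/
  (rank_lt r (gr_rank G) /\
   exists2 Bs, Bs `<=` branches G &
     [/\ S = wsubgraph G r Bs, wconnected S &
         forall Bs', Bs `<=` Bs' -> Bs' `<=` branches G ->
           wconnected (wsubgraph G r Bs') -> Bs' = Bs]).

Definition free_ultrafilter (F : set_system nat) : Prop :=
  UltraFilter F /\ \bigcap_(A in F) A = set0.

Record galaxy (N : Type) := Galaxy {
  gal_hypernodes : set (set (nat -> N));
  gal_hyperbranches : set (set (set (nat -> N)))
}.

Section Enlargement.
Variables (N : Type) (F : set_system nat) (S : wgraph_data N).
Implicit Types X Y Z : set (nat -> N).

(** The [r]-hypernode represented by the sequence [x] of [r]-wnodes. *)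
Definition hclass (r : rank) (x : nat -> N) : set (nat -> N) :=
  [set y | (forall n, wnode_of_rank S r (y n)) /\ F [set n | y n = x n]].

Definition hypernode_of_rank (r : rank) X : Prop :=
  exists2 x, (forall n, wnode_of_rank S r (x n)) & X = hclass r x.

Definition hypernode X : Prop :=
  exists2 r, rank_le r (gr_rank S) & hypernode_of_rank r X.

Definition standard_hypernode X : Prop :=
  exists r v, [/\ rank_le r (gr_rank S), wnode_of_rank S r v &
                  X = hclass r (fun=> v)].

Definition hyperbranch (b : set (set (nat -> N))) : Prop :=
  exists x y, [/\ forall n, wnode_of_rank S (Fin 0) (x n),
                  forall n, wnode_of_rank S (Fin 0) (y n),
                  F [set n | branches S [set x n; y n]] &
                  b = [set hclass (Fin 0) x; hclass (Fin 0) y]].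

Variable r : rank.

Definition limitedly_distant X Y : Prop :=
  exists x y, [/\ X x, Y y &
    exists m, F [set n | (wdist S (x n) (y n) <= cnf_mono (rank_expo r) m)%O]].

Definition is_nodal_galaxy (U : set (set (nat -> N))) : Prop :=
  exists2 X, hypernode X & U = [set Y | hypernode Y /\ limitedly_distant Y X].

Definition galaxy_of (U : set (set (nat -> N))) : galaxy N :=
  Galaxy U [set b | hyperbranch b /\ b `<=` U].

Definition is_galaxy (A : galaxy N) : Prop :=
  exists2 U, is_nodal_galaxy U & A = galaxy_of U.

Definition principal_galaxy : galaxy N :=
  galaxy_of [set X | hypernode X /\
                     exists2 Z, standard_hypernode Z & limitedly_distant X Z].

Definition closer (A B : galaxy N) : Prop :=
  exists X Y Z, exists x y z : nat -> N,
    [/\ gal_hypernodes principal_galaxy X /\ X x,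
        gal_hypernodes A Y /\ Y y,
        gal_hypernodes B Z /\ Z z &
        forall m, F [set n |
          (cnf_add (wdist S (y n) (x n)) (cnf_mono (rank_expo r) m)
             <= wdist S (z n) (x n))%O]].

End Enlargement.

Definition partially_orders (T : Type) (A : set T) (R : T -> T -> Prop) : Prop :=
  [/\ forall a, A a -> R a a,
      forall a b, A a -> A b -> R a b -> R b a -> a = b &
      forall a b c, A a -> A b -> A c -> R a b -> R b c -> R a c].

(* Main.v *)
Require Import Defs.
From mathcomp Require Import all_boot all_order all_algebra zify.
From mathcomp Require Import boolp classical_sets functions filter.
From Stdlib Require Import Relation_Operators.
From Stdlib Require Operators_Properties.

(** Every walk of rank at most r has length below omega^r * omega, so a
    wdistance d is governed, up to omega^r, by one natural number D: the
    coefficient of omega^r in d.  D is symmetric and satisfies the triangle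
    inequality up to an additive constant, and galaxies are the classes of
    sequences of wnodes at bounded D from one another.  Hence "closer" compares
    D up to bounded errors, does not depend on the chosen representatives, and
    is asymmetric and transitive.

    The triangle inequality comes from concatenating walks at a wnode y.  If one
    of the two constituents meeting there arrives through a tip of y of the
    highest rank, the walks are juxtaposed at y; otherwise both constituents
    reach the exceptional element of y (or y has lower rank), and they are merged
    into one constituent by induction on the rank.  A merged constituent
    contributes at most 2 to D. *)

Set Implicit Arguments.
Unset Strict Implicit.
Unset Printing Implicit Defensive.

Import Order.TTheory GRing.Theory Num.Theory.
Local Open Scope classical_set_scope.
Local Open Scope ring_scope.

(** * Ordinals *)

(** Two obstacles shape the proof. A wnode at an outer end of a merged constituent may meet the
    requirement of being reached through a wtip of the highest rank only thanks to the constituent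
    that has been replaced. The induction on the rank therefore also asserts that such wtips survive
    ([keeps_left], [keeps_right]). Moreover the rank [Arrow] has no predecessor, so the step from
    one rank to the next does not reach it; there, a link of natural-number rank is absorbed into
    the increasing ranks of an [Arrow]-walk. The additive error is harmless, because galaxies and
    closeness only see values of D up to bounded amounts. Finally, [wdist] is a chosen minimum, so
    the order on [cnf] has to be shown well-founded before anything can be said about it. *)

Definition weight (e : expo) (c : cnf) : nat := count_mem e (cnf_exps c).

(** Says that [c] is below omega^e * omega. On such ordinals [weight e] is the coefficient of the
    highest power that can occur, and is therefore monotone. *)
Definition bounded_by (e : expo) (c : cnf) : bool :=
  all (fun a => a <= e)%O (cnf_exps c).

Lemma weight_add e a b : weight e (cnf_add a b) = (weight e a + weight e b)%N.
Proof.
by rewrite /weight (permP (permEl (perm_merge _ _ _))) count_cat.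
Qed.

Lemma bounded_by_add e a b :
  bounded_by e (cnf_add a b) = bounded_by e a && bounded_by e b.
Proof.
by rewrite /bounded_by (perm_all _ (permEl (perm_merge _ _ _))) all_cat.
Qed.

Lemma weight_mono e f n : weight e (cnf_mono f n) = ((f == e) * n)%N.
Proof. by rewrite /weight /= count_nseq. Qed.

Lemma bounded_by_mono e f n : (f <= e)%O -> bounded_by e (cnf_mono f n).
Proof. by move=> fe; rewrite /bounded_by all_nseq fe orbT. Qed.

Lemma weight_sum e n (F : nat -> cnf) :
  weight e (\big[cnf_add/cnf0]_(i < n) F i) = (\sum_(i < n) weight e (F i))%N.
Proof.
elim: n F => [|n IH] F; first by rewrite !big_ord0.
by rewrite !big_ord_recl weight_add (IH (fun i => F i.+1)).
Qed.

Lemma bounded_by_sum e n (F : nat -> cnf) :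
  (forall i, (i < n)%N -> bounded_by e (F i)) ->
  bounded_by e (\big[cnf_add/cnf0]_(i < n) F i).
Proof.
elim: n F => [|n IH] F h; first by rewrite big_ord0.
rewrite big_ord_recl bounded_by_add h //= (IH (fun i => F i.+1)) // => i ?.
exact: h.
Qed.


(** All copies of [e] stand at the front of the sorted [t]. Having fewer of them, [s] ends or drops
    below [e] at a place where [t] still has [e]. *)
Lemma lexi_lt_of_count (e : expo) (s t : seqlexi expo) :
  sorted expo_ge t -> all (fun a => a <= e)%O s -> all (fun a => a <= e)%O t ->
  (count_mem e s < count_mem e t)%N -> (s < t)%O.
Proof.
elim: s t => [|a s IH] [|b t] //= pt /andP[ae sa] /andP[be ta].
have tb : all (fun a => a <= b)%O t.
  by apply: (order_path_min _ pt) => u v w; rewrite /expo_ge => /[swap]; apply: le_trans.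
have [eb|nbe] := eqVneq b e.
  move=> h; rewrite ltxi_cons eb ae /=; apply/implyP => ea.
  apply: IH => //; first exact: path_sorted pt.
  have aE : a = e by apply: le_anti; rewrite ae ea.
  by move: h; rewrite aE eqxx !add1n ltnS.
suff -> : count_mem e t = 0%N by rewrite ltn0.
apply/count_memPn/negP => /(allP tb) eb.
by move: nbe; rewrite eq_le be eb.
Qed.

Lemma weight_lt e a b : bounded_by e a -> bounded_by e b ->
  (weight e a < weight e b)%N -> (a < b)%O.
Proof.
move=> ha hb; rewrite /weight => h.
exact: (lexi_lt_of_count (cnf_sorted b) ha hb h).
Qed.

Lemma weight_le e a b : bounded_by e a -> bounded_by e b ->
  (a <= b)%O -> (weight e a <= weight e b)%N.
Proof.
move=> ha hb ab; rewrite leqNgt; apply/negP => /(weight_lt hb ha).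
by rewrite ltNge ab.
Qed.

(** * Well-foundedness of the order of the ordinals *)

Lemma nat_min (A : set nat) : A !=set0 ->
  exists2 m, A m & forall n, A n -> (m <= n)%N.
Proof.
move=> A0; have ex : exists n, `[< A n >] by case: A0 => n An; exists n; apply/asboolP.
by case: (ex_minnP ex) => m /asboolP Am h; exists m => // n /asboolP /h.
Qed.

Lemma expo_min (A : set expo) : A !=set0 ->
  exists2 m, A m & forall a, A a -> (m <= a)%O.
Proof.
case=> [[a0 b0] A0].
have [|a [b Aab] amin] := @nat_min [set a | exists b, A (a, b)].
  by exists a0, b0.
have [|b' Ab' bmin] := @nat_min [set b | A (a, b)]; first by exists b.
exists (a, b') => // -[c d] Acd; rewrite lexi_pair !leEnat; apply/andP; split.
  by apply: amin; exists d.
apply/implyP => ca; apply: bmin.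
suff -> : a = c by [].
by apply: anti_leq; rewrite ca amin //; exists d.
Qed.

Lemma expo_ind (P : expo -> Prop) :
  (forall e, (forall e', (e' < e)%O -> P e') -> P e) -> forall e, P e.
Proof.
move=> h e; apply: contrapT => nP.
have [|m nPm mmin] := @expo_min (~` P); first by exists e.
apply: (nPm); apply: h => e' em; apply: contrapT => /mmin.
by rewrite leNgt em.
Qed.

Lemma sorted_split (e : expo) (s : seq expo) :
  sorted expo_ge s -> all (fun a => a <= e)%O s ->
  exists t, [/\ s = nseq (count_mem e s) e ++ t, sorted expo_ge t &
                all (fun a => a < e)%O t].
Proof.
elim: s => [|a s IH] /=; first by exists [::].
move=> ps /andP[ae sa]; have [t [es st te]] := IH (path_sorted ps) sa.
have sb : all (fun b => b <= a)%O s.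
  by apply: (order_path_min _ ps) => u v w; rewrite /expo_ge => /[swap]; apply: le_trans.
have [aE|nae] := eqVneq a e; first by exists t; rewrite add1n /= -es aE.
have lae : (a < e)%O by rewrite lt_neqAle nae.
have se : all (fun b => b < e)%O s.
  by apply: sub_all sb => b ba; apply: le_lt_trans lae.
exists (a :: s); rewrite /= lae se; split => //.
rewrite add0n; suff -> : count_mem e s = 0%N by [].
by apply/count_memPn/negP => /(allP se); rewrite ltxx.
Qed.

Lemma lexi_cat2l (s t u : seqlexi expo) :
  (((s ++ t : seqlexi expo) <= (s ++ u : seqlexi expo))%O = (t <= u)%O).
Proof. by elim: s => //= a s IH; rewrite eqhead_lexiE. Qed.

(** Induction on the bound [e]. Take the least first exponent [a], then the least number [n] of
    copies of [a]: the minimum begins in this way, and the remainders have exponents below [a].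
    Sortedness is essential, since prefixing ever more small exponents to arbitrary sequences gives
    an infinite descent. *)
Lemma lexi_min (e : expo) (A : set (seqlexi expo)) : A !=set0 ->
  (forall s, A s -> sorted expo_ge s /\ all (fun a => a < e)%O s) ->
  exists2 m, A m & forall s, A s -> (m <= s)%O.
Proof.
elim/expo_ind: e A => e IH A [s0 A0] As.
have [An|nA0] := pselect (A [::]); first by exists [::].
have [|a [t0 At0] amin] := @expo_min [set a | exists t, A (a :: t)].
  by case: s0 A0 => [//|a t] A0; exists a, t.
have [|n [t1 At1 n1] nmin] :=
    @nat_min [set n | exists2 t, A (a :: t) & n = count_mem a (a :: t)].
  by exists (count_mem a (a :: t0)), t0.
have ae : (a < e)%O by have [_ /=] := As _ At0; case/andP.
have le_a t : A (a :: t) -> all (fun b => b <= a)%O (a :: t).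
  move=> /As[/= pt _]; rewrite lexx /=.
  by apply: (order_path_min _ pt) => u v w; rewrite /expo_ge => /[swap]; apply: le_trans.
have [||m [Am ma ms] mmin] := IH a ae
    [set t | [/\ A (nseq n a ++ t), all (fun b => b < a)%O t & sorted expo_ge t]].
- have [t [E st ta]] := sorted_split (As _ At1).1 (le_a _ At1).
  by exists t; split => //; rewrite n1 -E.
- by move=> s [].
exists (nseq n a ++ m) => // s sA.
have la : all (fun b => b <= a)%O (nseq n a ++ m : seq expo).
  rewrite all_cat all_nseq lexx orbT /=.
  by apply: sub_all ma => ? /ltW.
case: s sA => [//|b s] sA.
have ab : (a <= b)%O by apply: amin; exists s.
have [ba|] := eqVneq b a; last first.
  move=> nba; have n0 : (0 < n)%N by rewrite n1 /= eqxx.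
  case: n n0 {n1 nmin Am mmin la} => // n _ /=; rewrite neqhead_lexiE.
    by rewrite lt_neqAle eq_sym nba.
  by rewrite eq_sym.
subst b; have : (n <= count_mem a (a :: s))%N by apply: nmin; exists s.
have cm : count_mem a (nseq n a ++ m : seq expo) = n.
  rewrite count_cat count_nseq /= eqxx mul1n; suff -> : count_mem a m = 0%N by rewrite addn0.
  by apply/count_memPn/negP => /(allP ma); rewrite ltxx.
rewrite leq_eqVlt => /orP[/eqP nE|lt]; last first.
  apply/ltW/(@lexi_lt_of_count a _ _ (As _ sA).1 la (le_a _ sA)).
  by rewrite cm.
have [t [E st ta]] := sorted_split (As _ sA).1 (le_a _ sA).
rewrite E -nE lexi_cat2l; apply: mmin; split => //.
by rewrite nE -E.
Qed.

Lemma cnf_min (A : set cnf) : A !=set0 ->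
  exists2 m, A m & forall a, A a -> (m <= a)%O.
Proof.
case=> c Ac.
(* It suffices to search among the members up to some [c]: their exponents are at most the leading
   exponent of [c], and raising its second component by 1 makes the bound strict. *)
pose B := [set s | exists2 a, A a & (a <= c)%O /\ s = cnf_exps a].
pose h := head (0%N, 0%N) (cnf_exps c) : expo.
have [||m [a Aa [ac ->]] mmin] := @lexi_min (h.1, h.2.+1) B.
- by exists (cnf_exps c), c.
- move=> s [a Aa [ac ->]]; split; first exact: cnf_sorted.
  have {}ac : (cnf_exps a <= cnf_exps c)%O := ac.
  have := cnf_sorted a; case E : (cnf_exps a) ac => [//|b t] /=.
  rewrite /h; case: (cnf_exps c) => [|d u] //=; rewrite ?lexi_cons => // /andP[bd _] pt.
  have bh : (b < (d.1, d.2.+1) :> expo)%O.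
    apply: le_lt_trans bd _; case: (d) => d1 d2.
    by rewrite ltxi_pair lexx /= ltEnat /= leqnn.
  rewrite bh /=.
  have : all (fun a => a <= b)%O t.
    by apply: (order_path_min _ pt) => u' v w; rewrite /expo_ge => /[swap]; apply: le_trans.
  by apply: sub_all => x xb; apply: le_lt_trans bh.
exists a => // b Ab; have [bc|/ltW cb] := leP b c; last exact: le_trans cb.
by apply: (mmin (cnf_exps b)); exists b.
Qed.

(** * Reversing and shifting walks *)

Section WalkOperations.
Variable N : Type.
Implicit Types v w : pwalk N.

Lemma wrevK : involutive (@wrev N).
Proof.
have oppK (a : option int) : omap -%R (omap -%R a) = a by case: a => //= l; rewrite opprK.
elim=> [a b x|r a b x W IH] /=; rewrite !oppK.
  by congr Walk0; apply/funext => i; rewrite opprK.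
congr WalkS; apply/funext => i; first by rewrite opprK.
by rewrite IH; congr W; lia.
Qed.

Lemma inside_opp a b i : inside (omap -%R b) (omap -%R a) i = inside a b (- i).
Proof. by rewrite /inside; case: a => [l|]; case: b => [h|] //=; lia. Qed.

Lemma wlo_rev w : wlo (wrev w) = omap -%R (whi w). Proof. by case: w. Qed.
Lemma whi_rev w : whi (wrev w) = omap -%R (wlo w). Proof. by case: w. Qed.
Lemma wrank_rev w : wrank (wrev w) = wrank w. Proof. by case: w. Qed.
Lemma wnode_rev w i : wnode (wrev w) i = wnode w (- i). Proof. by case: w. Qed.

Lemma winside_rev w i : winside (wrev w) i = winside w (- i).
Proof. by rewrite /winside wlo_rev whi_rev inside_opp. Qed.

Lemma wpiece_rev w i : wpiece (wrev w) i = wrev (wpiece w (- i - 1)).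
Proof.
case: w => //= a b x; congr Walk0; congr Some; lia.
Qed.

Lemma nontrivial_rev w : nontrivial (wrev w) <-> nontrivial w.
Proof.
suff h v : nontrivial v -> nontrivial (wrev v).
  by split => [/h|/h //]; rewrite wrevK.
move=> [i [h1 h2]]; exists (- i - 1); rewrite !winside_rev.
have -> : - (- i - 1) = i + 1 by lia.
by have -> : - (- i - 1 + 1) = i by lia.
Qed.

Definition oshift (k : int) : option int -> option int := omap (fun i => i + k).

(** Reindexing serves to place the junction of two walks at index 0. *)
Definition wshift (k : int) w : pwalk N :=
  match w with
  | Walk0 a b x => Walk0 (oshift k a) (oshift k b) (fun i => x (i - k))
  | WalkS r a b x W =>
      WalkS r (oshift k a) (oshift k b) (fun i => x (i - k)) (fun i => W (i - k))
  end.

Lemma inside_shift k a b i : inside (oshift k a) (oshift k b) i = inside a b (i - k).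
Proof. by rewrite /inside; case: a => [l|]; case: b => [h|] //=; lia. Qed.

Lemma wlo_shift k w : wlo (wshift k w) = oshift k (wlo w). Proof. by case: w. Qed.
Lemma whi_shift k w : whi (wshift k w) = oshift k (whi w). Proof. by case: w. Qed.
Lemma wnode_shift k w i : wnode (wshift k w) i = wnode w (i - k).
Proof. by case: w. Qed.

Lemma winside_shift k w i : winside (wshift k w) i = winside w (i - k).
Proof. by rewrite /winside wlo_shift whi_shift inside_shift. Qed.

Lemma wrev_shift k w : wrev (wshift k w) = wshift (- k) (wrev w).
Proof.
have os (a : option int) : omap -%R (oshift k a) = oshift (- k) (omap -%R a).
  by case: a => //= l; congr Some; lia.
case: w => [a b x|r a b x W] /=; rewrite !os.
  by congr Walk0; apply/funext => i; congr x; lia.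
congr WalkS; apply/funext => i; first by congr x; lia.
by congr wrev; congr W; lia.
Qed.

Lemma nontrivial_shift k w : nontrivial w -> nontrivial (wshift k w).
Proof.
move=> [i [h1 h2]]; exists (i + k); rewrite !winside_shift.
by split; [move: h1|move: h2]; congr (is_true (winside w _)); lia.
Qed.

Lemma wlength_shift k w : wlength (wshift k w) = wlength w.
Proof.
case: w => [[l|] [h|] x|r [l|] [h|] x W] //=.
  by congr (cnf_mono _ `|_|); lia.
have -> : h + k - (l + k) = h - l by lia.
by apply: eq_bigr => i _; congr wlength; congr W; rewrite addrAC addrK.
Qed.

(** Asks for literally equal wnodes and constituents from some point on, instead of [same_walk].
    Shifts and splices produce exactly this, and tip equivalence is then carried along by
    rewriting. *)
Definition same_tail v w : Prop :=
  match v, w with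
  | Walk0 _ b x, Walk0 _ b' x' =>
      [/\ b = None, b' = None &
          exists k m : int, forall i, m <= i -> x' (i + k) = x i]
  | WalkS r _ b x W, WalkS r' _ b' x' W' =>
      [/\ r = r', b = None, b' = None &
          exists k m : int, forall i, m <= i -> x' (i + k) = x i /\ W' (i + k) = W i]
  | _, _ => False
  end.

Lemma same_tail_whi v w : same_tail v w -> whi v = None /\ whi w = None.
Proof. by case: v => [a b x|r a b x W]; case: w => [a' b' x'|r' a' b' x' W'] //= []. Qed.

Lemma same_tail_trans w1 w2 w3 : same_tail w1 w2 -> same_tail w2 w3 -> same_tail w1 w3.
Proof.
case: w1 => [? ? x1|? ? ? x1 W1]; case: w2 => [? ? x2|? ? ? x2 W2];
  case: w3 => [? ? x3|? ? ? x3 W3] //=.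
  move=> [-> -> [k [m h]]] [_ -> [k' [m' h']]]; split => //.
  exists (k + k'), (Num.max m (m' - k)) => i hi.
  by rewrite addrA h' ?h //; lia.
move=> [-> -> -> [k [m h]]] [-> _ -> [k' [m' h']]]; split => //.
exists (k + k'), (Num.max m (m' - k)) => i hi.
have [|e1 e2] := h' (i + k); first by lia.
have [|e3 e4] := h i; first by lia.
by rewrite addrA e1 e2.
Qed.

Lemma same_tail_shift k w : whi w = None -> same_tail w (wshift k w).
Proof.
case: w => [a b x|r a b x W] /= -> ; split => //; exists k, 0 => i _ /=; by rewrite addrK.
Qed.

End WalkOperations.

Section WalkReversal.
Variables (N : Type) (G : wgraph_data N).
Implicit Types (x y z : N) (v w : pwalk N).

Lemma embraces_refl x : embraces G x x. Proof. exact: rt1n_refl. Qed.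

Lemma embraces_trans x y z : embraces G x y -> embraces G y z -> embraces G x z.
Proof. by elim=> // a b c ab _ IH /IH; apply: rt1n_trans. Qed.

Lemma embraces_elts x y z : elts G x y -> embraces G y z -> embraces G x z.
Proof. exact: rt1n_trans. Qed.

Lemma reaches_right_embraces w x y :
  embraces G x y -> reaches_right G w y -> reaches_right G w x.
Proof.
rewrite /reaches_right; case: (whi w) => [h|] xy; first exact: embraces_trans.
move=> [t [q yq tq] h]; exists t => //; exists q => //.
exact: embraces_trans yq.
Qed.

Lemma reaches_left_embraces w x y :
  embraces G x y -> reaches_left G w y -> reaches_left G w x.
Proof. exact: reaches_right_embraces. Qed.

Lemma reaches_right_rev w x : reaches_right G (wrev w) x = reaches_left G w x.
Proof. by []. Qed.

Lemma reaches_left_rev w x : reaches_left G (wrev w) x = reaches_right G w x.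
Proof. by rewrite /reaches_left wrevK. Qed.

Lemma arrow_shape_rev w : arrow_shape G w -> arrow_shape G (wrev w).
Proof.
rewrite /arrow_shape wlo_rev whi_rev.
case: (wlo w) => [l|]; case: (whi w) => [h|] //=; rewrite ?wrevK ?opprK //.
by move=> [c [h1 h2]]; exists (- c); rewrite opprK.
Qed.

Lemma ranked_shape_rev r w : ranked_shape G r w -> ranked_shape G r (wrev w).
Proof.
move=> [s rs [h1 h2 h3]]; exists s => //; split.
- by move=> i; rewrite winside_rev wnode_rev; apply: h1.
- move=> i; rewrite !winside_rev wpiece_rev wrank_rev => i1 i2.
  apply: h2; first by move: i2; congr (is_true (winside w _)); lia.
  by move: i1; congr (is_true (winside w _)); lia.
move=> i; rewrite !winside_rev !wpiece_rev wnode_rev => i1 i2 i3.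
have [|||-> h] := h3 (- i) => //.
- by move: i3; congr (is_true (winside w _)); lia.
- by move: i1; congr (is_true (winside w _)); lia.
split => //; rewrite !whi_rev !wlo_rev !wrank_rev.
have -> : - (i - 1) - 1 = - i by lia.
case: h => -[-> ->]; by [right|left].
Qed.

Lemma is_walk_rev w : is_walk G w -> is_walk G (wrev w).
Proof.
elim: w => [a b x|r a b x W IH] /=.
  move=> [[i ii] h1 h2]; split.
  - by exists (- i); rewrite inside_opp opprK.
  - by move=> j; rewrite inside_opp; apply: h1.
  move=> j; rewrite !inside_opp => j1 j2; rewrite setUC.
  have e : - j = - (j + 1) + 1 by lia.
  by rewrite e; apply: h2 => //; rewrite -e.
move=> [h0 [i ii] h1 h2 h3]; split => //.
- by exists (- i); rewrite inside_opp opprK.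
- by move=> j; rewrite inside_opp; apply: h1.
- move=> j; rewrite !inside_opp => j1 j2.
  have e1 : - j - 1 + 1 = - j by lia.
  have e2 : - (j + 1) = - j - 1 by lia.
  have [||w1 w2 w3 w4] := h2 (- j - 1); rewrite ?e1 -?e2 //.
  rewrite e2; split.
  + exact: IH.
  + exact/nontrivial_rev.
  + by rewrite reaches_left_rev; move: w4; rewrite e1.
  + by rewrite reaches_right_rev.
case: r h0 h3 => [n||] _ h3; first exact: (ranked_shape_rev h3).
  exact: (arrow_shape_rev h3).
exact: (ranked_shape_rev h3).
Qed.

End WalkReversal.

(** * Wtips are determined by tails *)

Section Tails.
Variables (N : Type) (G : wgraph_data N).
Implicit Types (x y z : N) (u v w : pwalk N).

Lemma walk_traversal w : is_walk G w -> nontrivial w ->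
  exists p, traversed w p <> None.
Proof.
elim: w => [a b x|r a b x W IH] /= hw [i []]; rewrite /winside /= => h1 h2.
  by exists [:: i] => /=; rewrite h1 h2.
case: hw => _ _ _ /(_ i h1 h2)[w1 w2 _ _] _.
have [p hp] := IH i w1 w2.
by exists (i :: p); rewrite /= h1 h2.
Qed.

(** The pieces of a 0-walk carry their own indices as bounds, so corresponding pieces of two 0-walks
    with the same tail agree only up to a shift. *)
Lemma same_walk_shift0 w a b (x : int -> N) a' b' (x' : int -> N) (k : int) :
  same_walk w (Walk0 a b x) ->
  (forall i, inside a b i = inside a' b' (i + k)) ->
  (forall i, inside a b i -> x i = x' (i + k)) ->
  same_walk w (Walk0 a' b' x' : pwalk N).
Proof.
move E : (Walk0 a b x) => u h; case: h E => // c d y c' d' y' k' h1 h2 [-> -> ->] h3 h4.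
apply: (@same_walk0 _ _ _ _ _ _ _ (k' + k)) => i; first by rewrite h1 h3 addrA.
by move=> ci; rewrite addrA h2 // h4 // -h1.
Qed.

Lemma eventually_same_tail u v w :
  eventually_same u v -> same_tail v w -> eventually_same u w.
Proof.
move=> [k [m h]]; case: v h => [a b x|r a b x W] h; case: w => [a' b' x'|r' a' b' x' W'] //=.
  move=> [_ _ [k' [m' h']]]; exists (k + k'), (Num.max m (m' - k)) => i hi.
  have [|h1 h2] := h i; first by lia.
  split; first by rewrite h1 /= addrA h' //; lia.
  apply: (same_walk_shift0 (k := k') h2) => j; rewrite /inside; first by lia.
  by move=> hj; rewrite h' //; lia.
move=> [_ _ _ [k' [m' h']]]; exists (k + k'), (Num.max m (m' - k)) => i hi.
have [|h1 h2] := h i; first by lia.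
have [|h3 h4] := h' (i + k); first by lia.
by rewrite /= addrA h3 h4.
Qed.

(** Reindexing the outermost walk changes the position of a branch traversal in its first entry
    only. *)
Definition shift_head (k : int) (p : seqlexi int) : seqlexi int :=
  if p is i :: q then (i + k) :: q else [::].

Lemma shift_head_lt k p q : (shift_head k p < shift_head k q)%O = (p < q)%O.
Proof.
case: p q => [|i p] [|j q] //=; rewrite !ltxi_cons.
by rewrite !lerD2r.
Qed.

Lemma shift_headK k : cancel (shift_head k) (shift_head (- k)).
Proof. by case=> //= i p; rewrite addrK. Qed.

Lemma shift_head_le k p q : (shift_head k p <= shift_head k q)%O = (p <= q)%O.
Proof. by rewrite !leNgt shift_head_lt. Qed.

Lemma homo_le_of_lt (A : set (seqlexi int)) (f : seqlexi int -> seqlexi int) :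
  {in A &, {homo f : s t / (s < t)%O}} ->
  forall s t, A s -> A t -> (f s <= f t)%O = (s <= t)%O.
Proof.
move=> h s t As At; apply/idP/idP.
  rewrite !leNgt; apply: contraNN => ts.
  by apply: h => //; apply/mem_set.
rewrite le_eqVlt => /orP[/eqP ->//|st].
by apply/ltW/h => //; apply/mem_set.
Qed.

(** The order isomorphism between the traversals of [u] and [v] is restricted to a later starting
    position, beyond which [v] and [w] have the same constituents, and is then composed with the
    shift of the first index. *)
Lemma traversals_tail u v w : is_walk G v -> nontrivial v -> wrank v = Arrow ->
  eventually_same_traversals u v -> same_tail v w -> eventually_same_traversals u w.
Proof.
case: v => [//|r a b x W] hv nv /= _; case: w => [//|r' a' b' x' W'].
move=> [p [q [f [[hp hq] [fbij finj fsurj] fhomo ftrav]]]].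
move=> [_ bN bN' [k [m h]]]; subst b b'.
case: q hq fbij fsurj ftrav => [//|c q] hq fbij fsurj ftrav.
have [l li] : exists l : int, inside a None l by case: nv => l []; exists l.
pose low (o : option int) : int := if o is Some i then i else 0.
(* The index [j] lies inside [v], in the common tail, strictly past the first entry of the old
   starting position, and [j + k] lies inside [w]. If [w] is unbounded on the left, the default 0 in
   [low] is harmless. *)
pose j : int := Num.max (Num.max l m) (Num.max (c + 1) (low a' - k)).
have inv i : j <= i -> inside a None i /\ inside a' None (i + k).
  move: li; rewrite /j /low /inside; case: (a) => [o|]; case: (a') => [o'|]; lia.
have [s hs] : exists s, traversed (W j) s <> None.
  case: hv => _ _ _ /(_ j (inv j (lexx _)).1) hv _.
  by case: hv => [|h1 h2 _ _]; [apply: (inv _ _).1; lia|exact: walk_traversal h1 h2].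
have trW i t : j <= i -> traversed (WalkS r' a' None x' W') ((i + k) :: t) =
    traversed (WalkS r a None x W) (i :: t).
  move=> ji /=; have [-> ->] := inv i ji.
  have [|i1 i2] := inv (i + 1); first by lia.
  rewrite addrAC i1 i2 /=; have [|_ ->//] := h i; by lia.
have trj : traversed (WalkS r a None x W) (j :: s) <> None.
  move=> /=; have [-> _] := inv j (lexx _).
  by have [|-> _] := inv (j + 1); first by lia.
have qs : ((c :: q : seqlexi int) <= (j :: s : seqlexi int))%O.
  rewrite lexi_cons; apply/andP; split; first by rewrite /j; lia.
  by apply/implyP; rewrite /j; lia.
have [p' [pp' hp'] fp'] := fsurj (j :: s) (conj qs trj).
have sub t : traversals_from u p' t -> traversals_from u p t.
  by move=> [h1 h2]; split => //; apply: le_trans h1.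
have Ap' : traversals_from u p p' by [].
have fle := homo_le_of_lt fhomo.
(* By monotonicity the positions from [p'] on are sent to positions from [j :: s] on, whose first
   index is at least [j]. *)
have fhead t : traversals_from u p' t -> exists i o, j <= i /\ f t = i :: o.
  move=> At; have := fle _ _ Ap' (sub _ At); rewrite At.1 fp'.
  case: (f t) => [//|i o]; rewrite lexi_cons => /andP[ji _]; by exists i, o.
exists p', ((j + k) :: s), (shift_head k \o f); split => /=.
- by split => //; have := trW j s (lexx _) => /= ->.
- split.
  + move=> t At /=; have [i [o [ji E]]] := fhead _ At; split.
      rewrite -[X in (X <= _)%O]/(shift_head k (j :: s)) shift_head_le -fp' fle //.
        exact: At.1.
      exact: sub.
    rewrite E trW // -E ftrav; [exact: At.2|exact: sub].
  + move=> t t' /set_mem At /set_mem At' /= /(can_inj (shift_headK k)) E.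
    by apply: finj => //; apply/mem_set; apply: sub.
  + move=> [|i o] [o1 o2] //.
    have ji : j <= i - k by move: o1; rewrite lexi_cons => /andP[]; lia.
    have E : i :: o = shift_head k ((i - k) :: o) by rewrite /= subrK.
    have o3 : ((j :: s : seqlexi int) <= ((i - k) :: o : seqlexi int))%O.
      by move: o1; rewrite E -[X in (X <= _)%O]/(shift_head k (j :: s)) shift_head_le.
    have [|t At ft] := fsurj ((i - k) :: o).
      split; first exact: le_trans o3.
      by rewrite -trW // subrK.
    exists t; last by rewrite /= ft E.
    split; last exact: At.2.
    by rewrite -(fle _ _ Ap' At) fp' ft.
- move=> t t' /set_mem At /set_mem At' tt' /=; rewrite shift_head_lt.
  by apply: fhomo => //; apply/mem_set; apply: sub.
move=> t At; have [i [o [ji E]]] := fhead _ At.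
rewrite -(ftrav _ (sub _ At)) E -trW //.
Qed.

Lemma tip_equiv_tail u v w : is_walk G v -> nontrivial v ->
  tip_equiv u v -> same_tail v w -> tip_equiv u w.
Proof.
move=> hv nv [u1 u2 u3 u4] vw; have [_ w1] := same_tail_whi vw.
have vwr : wrank v = wrank w.
  by case: v vw {hv nv u2 u3 u4} => [???|?????]; case: w {w1} => [???|?????] //= [].
split => //; first by rewrite u3.
case ur : (wrank u) u4 => [n||] u4; try exact: eventually_same_tail vw.
by apply: traversals_tail vw => //; rewrite -u3.
Qed.

Lemma reaches_right_tail v w x : is_walk G v -> nontrivial v ->
  same_tail v w -> reaches_right G v x -> reaches_right G w x.
Proof.
move=> hv nv vw; have [v1 w1] := same_tail_whi vw.
rewrite /reaches_right v1 w1 => -[t xt [u tu uv]]; exists t => //; exists u => //.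
exact: tip_equiv_tail uv vw.
Qed.

End Tails.

(** * Ranks and constituents *)

Lemma rank_le_refl r : rank_le r r. Proof. by case: r => /=. Qed.

Lemma rank_le_trans r s t : rank_le r s -> rank_le s t -> rank_le r t.
Proof. by case: r => [m||]; case: s => [n||]; case: t => [p||] //=; apply: leq_trans. Qed.

Lemma rank_pred_le r s t : rank_pred r = Some s ->
  rank_le t r = (rank_le t s \/ t = r) :> Prop.
Proof.
move=> rs; apply/propext; case: r rs => [[|n]||] //= [<-]; case: t => [m||] //=; split => //.
- by rewrite leq_eqVlt => /orP[/eqP ->|]; [right|left].
- by case=> [/leqW//|[->]].
- by case.
- by case.
- by left.
- by left.
- by right.
Qed.

Lemma rank_pred_lt r s t : rank_pred r = Some s -> rank_le t s = rank_lt t r.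
Proof.
by case: r => [[|n]||] //= [<-]; case: t => [m||] //=; rewrite /rank_lt /=; lia.
Qed.

Lemma rank_pred_mono r s r' s' :
  rank_pred r = Some s -> rank_pred r' = Some s' -> rank_le s s' -> rank_le r r'.
Proof. by case: r => [[|n]||] //= [<-]; case: r' => [[|n']||] //= [<-]. Qed.

Lemma rank_ltxx r : rank_lt r r = false.
Proof. by rewrite /rank_lt rank_le_refl. Qed.

Lemma rank_lt_trans r s t : rank_lt r s -> rank_lt s t -> rank_lt r t.
Proof.
move=> /andP[rs nsr] /andP[st nts]; apply/andP; split; first exact: rank_le_trans st.
by apply: contraNN nsr => /(rank_le_trans st).
Qed.

(** The consequences of the axioms of wgraphs that concatenation of walks needs;
    unlike [is_wgraph] they pass to wsections. *)
Record embracing_structure (N : Type) (G : wgraph_data N) : Prop := EmbracingStructure {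
  es_rank : forall x, wnodes G x -> rank_le (rk G x) (gr_rank G);
  es_elts : forall x y, wnodes G x -> elts G x y -> wnodes G y;
  es_lt : forall x y, wnodes G x -> elts G x y -> rank_lt (rk G y) (rk G x);
  es_exceptional : forall x y y', wnodes G x -> rk G x <> Arrow ->
    elts G x y -> elts G x y' -> y = y';
  es_tips : forall x t v, wnodes G x -> tips G x t -> t v ->
    rank_pred (rk G x) = Some (wrank v);
  es_arrow : forall x y y', wnode_of_rank G Arrow x -> elts G x y -> elts G x y' ->
    embraces G y y' \/ embraces G y' y;
  es_comparable : forall x y z, wnodes G x -> wnodes G y ->
    embraces G x z -> embraces G y z -> embraces G x y \/ embraces G y x;
  es_maximal : forall x, wnodes G x ->
    exists2 y, is_maximal_wnode G y & embraces G y x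
}.

(** * Local description of walks, and the coefficients of their lengths *)

Section WalkStructure.
Variables (N : Type) (G : wgraph_data N).
Implicit Types (u v w : pwalk N).

Lemma ranked_shape_shift k r a b (x : int -> N) W :
  ranked_shape G r (WalkS r a b x W) -> ranked_shape G r (wshift k (WalkS r a b x W)).
Proof.
move=> [s rs [h1 h2 h3]]; exists s => //; split => i; rewrite !winside_shift /=.
- exact: h1.
- have -> : i + 1 - k = i - k + 1 by lia.
  apply: h2.
have -> : i + 1 - k = i - k + 1 by lia.
have -> : i - 1 - k = i - k - 1 by lia.
  apply: h3.
Qed.

Lemma arrow_from_shift k r a b (x : int -> N) W c :
  arrow_from G (WalkS r a b x W) c -> arrow_from G (wshift k (WalkS r a b x W)) (c + k).
Proof.
move=> h i ci /=; have -> : i + 1 - k = i - k + 1 by lia.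
by apply: h; lia.
Qed.

Lemma arrow_shape_shift k a b (x : int -> N) W :
  arrow_shape G (WalkS Arrow a b x W) -> arrow_shape G (wshift k (WalkS Arrow a b x W)).
Proof.
case: a => [l|]; case: b => [h|] //; rewrite /arrow_shape [wlo _]/= [whi _]/=.
- exact: arrow_from_shift.
- rewrite wrev_shift => h1; have := arrow_from_shift (k := - k) h1.
  by congr arrow_from; lia.
- move=> [c [h1 h2]]; exists (c + k); split; first exact: arrow_from_shift.
  rewrite wrev_shift; have := arrow_from_shift (k := - k) h2.
  by congr arrow_from; lia.
Qed.

Lemma is_walk_shift k w : is_walk G w -> is_walk G (wshift k w).
Proof.
case: w => [a b x|r a b x W].
  move=> [[i ii] h1 h2]; split.
  - by exists (i + k); rewrite inside_shift addrK.
  - by move=> j; rewrite inside_shift; apply: h1.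
  move=> j; rewrite !inside_shift.
  have -> : j + 1 - k = j - k + 1 by lia.
  apply: h2.
move=> [h0 [i ii] h1 h2 h3]; split => //.
- by exists (i + k); rewrite inside_shift addrK.
- by move=> j; rewrite inside_shift; apply: h1.
- move=> j; rewrite !inside_shift.
  have -> : j + 1 - k = j - k + 1 by lia.
  apply: h2.
case: r h0 h3 => [n||] _ h3; first exact: (ranked_shape_shift _ h3).
  exact: (arrow_shape_shift _ h3).
exact: (ranked_shape_shift _ h3).
Qed.

(** The condition on a constituent between [x] and [y] in a walk whose constituents have rank at
    most [s]. *)
Definition link (s : rank) w (x y : N) : Prop :=
  [/\ is_walk G w, nontrivial w, reaches_left G w x, reaches_right G w y &
      rank_le (wrank w) s].

Lemma link_rev s w x y : link s w x y -> link s (wrev w) y x.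
Proof.
move=> [h1 h2 h3 h4 h5]; split; first exact: is_walk_rev.
- exact/nontrivial_rev.
- by rewrite reaches_left_rev.
- by rewrite reaches_right_rev.
- by rewrite wrank_rev.
Qed.

Lemma link_embraces s w x y x' y' : embraces G x' x -> embraces G y' y ->
  link s w x y -> link s w x' y'.
Proof.
move=> hx hy [h1 h2 h3 h4 h5]; split => //.
  exact: reaches_left_embraces h3.
exact: reaches_right_embraces h4.
Qed.

Lemma link_le s s' w x y : rank_le s s' -> link s w x y -> link s' w x y.
Proof. by move=> ss' [h1 h2 h3 h4 h5]; split => //; apply: rank_le_trans ss'. Qed.

(** The condition at a nonterminal wnode [x] of a walk of rank [r] between its constituents [v] and
    [w]. *)
Definition turn (r s : rank) v (x : N) w : Prop :=
  rk G x = r /\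
  (whi v = None /\ wrank v = s \/ wlo w = None /\ wrank w = s).

(** For ranks with a predecessor, being a walk is a matter of single constituents and of pairs of
    neighbouring ones. After gluing, only the conditions near the junction have to be examined. *)
Lemma ranked_walkP r s a b (x : int -> N) W : rank_pred r = Some s ->
  is_walk G (WalkS r a b x W) <->
  [/\ rank_le r (gr_rank G), exists i, inside a b i,
      forall i, inside a b i -> wnodes G (x i) /\ rank_le (rk G (x i)) r,
      forall i, inside a b i -> inside a b (i + 1) -> link s (W i) (x i) (x (i + 1)) &
      forall i, inside a b (i - 1) -> inside a b i -> inside a b (i + 1) ->
        turn r s (W (i - 1)) (x i) (W i)].
Proof.
move=> rs; have rA : r <> Arrow by move=> rA; move: rs; rewrite rA.
have shapeE w : (if r is Arrow then arrow_shape G w else ranked_shape G r w) =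
    ranked_shape G r w by case: (r) rA.
have E : is_walk G (WalkS r a b x W) <->
  [/\ rank_le r (gr_rank G), exists i, inside a b i,
          forall i, inside a b i -> wnodes G (x i),
          forall i, inside a b i -> inside a b (i + 1) ->
            [/\ is_walk G (W i), nontrivial (W i),
                reaches_left G (W i) (x i) & reaches_right G (W i) (x (i + 1))] &
          ranked_shape G r (WalkS r a b x W)] by rewrite -shapeE.
rewrite {}E; split.
  move=> [h1 h2 h3 h4 [s' rs' [h5 h6 h7]]]; move: rs'; rewrite rs => -[ss]; subst s'.
  split => //; first by move=> i ii; split; [exact: h3|exact: h5].
  by move=> i i1 i2; have [? ? ? ?] := h4 i i1 i2; split => //; apply: h6.
move=> [h1 h2 h3 h4 h5]; split => //; first by move=> i /h3[].
  by move=> i i1 /(h4 i i1)[].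
exists s => //; split => //; first by move=> i /h3[].
by move=> i i1 /(h4 i i1)[].
Qed.

Lemma ranked_walk_pred r a b (x : int -> N) W : is_walk G (WalkS r a b x W) ->
  r <> Arrow -> exists s, rank_pred r = Some s.
Proof.
move=> [_ _ _ _ h] rA; suff [s rs _] : ranked_shape G r (WalkS r a b x W) by exists s.
by case: (r) rA h.
Qed.

Lemma arrow_walk_node a b (x : int -> N) W i : is_walk G (WalkS Arrow a b x W) ->
  inside a b i -> exists m, rk G (x i) = Fin m.
Proof.
move=> [_ _ _ _ h2] ii.
have fin w c : arrow_from G w c -> forall j, c <= j -> exists m, rk G (wnode w j) = Fin m.
  by move=> h j /h[m [n [-> _ _ _ _]]]; exists m.
move: h2 ii; rewrite /arrow_shape /inside /=; case: a => [l|]; case: b => [u|] //= h2.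
- by rewrite andbT => /(fin _ _ h2).
- by move=> ii; have := fin _ _ h2 (- i); rewrite /= opprK; apply; lia.
- case: h2 => c [h2 h3] _; have [/(fin _ _ h2)//|ic] := leP c i.
  by have := fin _ _ h3 (- i); rewrite /= opprK; apply; lia.
Qed.

Lemma walk_node_rank w i : is_walk G w -> winside w i ->
  wnodes G (wnode w i) /\ rank_le (rk G (wnode w i)) (wrank w).
Proof.
case: w => [a b x|r a b x W] hw.
  by case: hw => _ h _ /h[/= h1 ->].
have [rA|rA] := pselect (r = Arrow); last first.
  have [s rs] := ranked_walk_pred hw rA.
  by move/(ranked_walkP _ _ _ _ rs): hw => [_ _ h _ _] /h.
subst r => ii; have [m xm] := arrow_walk_node hw ii.
by case: hw => _ _ h1 _ _; split; [exact: h1|rewrite /= xm].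
Qed.

Lemma two_ended_not_arrow w : is_walk G w -> two_ended w -> wrank w <> Arrow.
Proof.
by case: w => [//|r [l|] [h|] x W] //= hw [] // _ _ rA; subst r; case: hw => _ _ _ _.
Qed.

(** A one-ended constituent of the highest possible rank has length exactly omega^r, so the
    coefficient of omega^r counts the infinite ends of such constituents. *)
Lemma one_ended_expo_pred r s : rank_pred r = Some s -> one_ended_expo s = rank_expo r.
Proof. by case: r => [[|n]||] //= [<-]. Qed.

Lemma expo_mono m n : (((0%N, m) : expo) <= (0%N, n))%O = (m <= n)%N.
Proof. by rewrite lexi_pair lexx. Qed.

Lemma one_ended_expo_le r s : rank_le r s -> (one_ended_expo r <= one_ended_expo s)%O.
Proof. by case: r => [m||]; case: s => [n||] //=; rewrite expo_mono. Qed.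

Lemma rank_expo_lt r : r <> Arrow -> (rank_expo r < one_ended_expo r)%O.
Proof.
by case: r => [m||] //= _; rewrite ltxi_pair lexx /= ltEnat /=.
Qed.

Lemma bounded_by_trans e f c : (e <= f)%O -> bounded_by e c -> bounded_by f c.
Proof. by move=> ef; apply: sub_all => a ae; apply: le_trans ef. Qed.

(** A two-ended walk is a finite natural sum of lengths of constituents of rank at most the
    predecessor [s], and the first bound, applied to these, gives exponents at most
    [one_ended_expo s = rank_expo r]. *)
Lemma wlength_bounded w : is_walk G w ->
  bounded_by (one_ended_expo (wrank w)) (wlength w) /\
  (two_ended w -> bounded_by (rank_expo (wrank w)) (wlength w)).
Proof.
elim: w => [a b x|r a b x W IH] hw.
  split; first by case: a {hw} => [l|]; case: b => [h|]; apply: bounded_by_mono.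
  by case: a {hw} => [l|] []; case: b => [h|] // _ _; apply: bounded_by_mono.
have te : two_ended (WalkS r a b x W) ->
    bounded_by (rank_expo r) (wlength (WalkS r a b x W)).
  move=> tw; have rA : r <> Arrow := two_ended_not_arrow hw tw.
  have [s rs] := ranked_walk_pred hw rA.
  move/(ranked_walkP _ _ _ _ rs): hw => [_ ab _ h _].
  case: a ab h tw => [l|] ab h []; case: b ab h => [u|] [j lu] h // _ _ /=.
  move: lu; rewrite /inside => lu.
  apply: (@bounded_by_sum _ _ (fun i => wlength (W (l + i%:Z)))) => i iu.
  have [||h1 h2 h3 h4 h5] := h (l + i%:Z); rewrite /inside; try lia.
  rewrite -(one_ended_expo_pred rs); apply: bounded_by_trans (IH _ h1).1.
  exact: one_ended_expo_le.
split => //; case: a te hw => [l|] te hw; case: b te hw => [u|] te hw; try exact: bounded_by_mono.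
have tw : two_ended (WalkS r (Some l) (Some u) x W) by [].
apply: bounded_by_trans (te tw); apply/ltW/rank_expo_lt.
exact: two_ended_not_arrow hw tw.
Qed.

Lemma weight0 e f c : (e < f)%O -> bounded_by e c -> weight f c = 0%N.
Proof.
by move=> ef /allP h; apply/count_memPn/negP => /h; rewrite leNgt ef.
Qed.

(** A two-ended constituent has only exponents below that of omega^r and contributes nothing; an
    infinite one has as its length one power of omega, taken once or, if it is endless, twice. *)
Lemma link_weight r s w x y : rank_pred r = Some s -> link s w x y ->
  (weight (rank_expo r) (wlength w) <= 2)%N.
Proof.
move=> rs [hw _ _ _ ws]; have [tw|ntw] := pselect (two_ended w).
  have h := (wlength_bounded hw).2 tw; rewrite (weight0 _ h) //.
  rewrite -(one_ended_expo_pred rs); apply: lt_le_trans (one_ended_expo_le ws).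
  exact/rank_expo_lt/(two_ended_not_arrow hw tw).
have mono f n : (n <= 2)%N -> (weight (rank_expo r) (cnf_mono f n) <= 2)%N.
  by move=> n2; rewrite weight_mono; case: eqP => //; rewrite mul1n.
case: w {hw ws} ntw => [[l|] [h|] a|r' [l|] [h|] a W] ntw; try exact: mono.
  by exfalso; apply: ntw.
by exfalso; apply: ntw.
Qed.

End WalkStructure.

(** * Concatenation *)

Section Splicing.
Variables (N : Type) (G : wgraph_data N).
Implicit Types (u v w : pwalk N).

(** Preserves all that reaching a wnode on the right depends on: the terminal wnode, or else the
    tail. *)
Definition same_right_end v w : Prop :=
  if whi v is Some h then exists2 h', whi w = Some h' & wnode w h' = wnode v h
  else same_tail v w.

Definition same_left_end v w : Prop := same_right_end (wrev v) (wrev w).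

Lemma same_right_end_trans u v w :
  same_right_end u v -> same_right_end v w -> same_right_end u w.
Proof.
rewrite /same_right_end; case: (whi u) => [h|].
  by move=> [h' -> <-].
move=> uv; have [_ ->] := same_tail_whi uv; exact: same_tail_trans.
Qed.

Lemma same_left_end_trans u v w :
  same_left_end u v -> same_left_end v w -> same_left_end u w.
Proof. exact: same_right_end_trans. Qed.

Lemma same_right_end_shift k w : same_right_end w (wshift k w).
Proof.
rewrite /same_right_end; case E : (whi w) => [h|]; last exact: same_tail_shift.
by exists (h + k); rewrite ?whi_shift ?E // wnode_shift addrK.
Qed.

Lemma same_left_end_shift k w : same_left_end w (wshift k w).
Proof. by rewrite /same_left_end wrev_shift; apply: same_right_end_shift. Qed.

Lemma same_right_end_None v w : same_right_end v w -> whi v = None -> whi w = None.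
Proof. by rewrite /same_right_end => + vN; rewrite vN => /same_tail_whi[]. Qed.

Lemma same_left_end_None v w : same_left_end v w -> wlo v = None -> wlo w = None.
Proof.
move=> /same_right_end_None; rewrite !whi_rev => h vN; move: h; rewrite vN.
by case: (wlo w) => // a /(_ erefl).
Qed.

Lemma same_right_end_Some v w h : same_right_end v w -> whi v = Some h ->
  exists2 h', whi w = Some h' & wnode w h' = wnode v h.
Proof. by rewrite /same_right_end => + vN; rewrite vN. Qed.

Lemma same_left_end_Some v w l : same_left_end v w -> wlo v = Some l ->
  exists2 l', wlo w = Some l' & wnode w l' = wnode v l.
Proof.
move=> /same_right_end_Some; rewrite !whi_rev => h vN; move: h; rewrite vN /=.
move=> /(_ _ erefl)[l']; case: (wlo w) => //= a [<-].
by rewrite !wnode_rev !opprK; exists a.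
Qed.

Lemma reaches_right_same_end v w x : is_walk G v -> nontrivial v ->
  same_right_end v w -> reaches_right G v x -> reaches_right G w x.
Proof.
move=> hv nv; rewrite /same_right_end; case E : (whi v) => [h|].
  by rewrite /reaches_right E => -[h' -> ->].
exact: reaches_right_tail.
Qed.

Lemma reaches_left_same_end v w x : is_walk G v -> nontrivial v ->
  same_left_end v w -> reaches_left G v x -> reaches_left G w x.
Proof.
move=> hv nv; apply: reaches_right_same_end; first exact: is_walk_rev.
exact/nontrivial_rev.
Qed.

Lemma splice_right_end r a' a b (x' x : int -> N) W' W (c : int) : inside None b c ->
  (forall i, c <= i -> x i = x' i /\ W i = W' i) ->
  same_right_end (WalkS r a' b x' W') (WalkS r a b x W).
Proof.
rewrite /same_right_end; case: b => [h|] /= hc hx.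
  by exists h => //; have [|-> _] := hx h; move: hc; rewrite /inside.
by split => //; exists 0, c => i /hx; rewrite addr0.
Qed.

Lemma splice_left_end r a b' b (x' x : int -> N) W' W (c : int) : inside a None c ->
  (forall i, i <= c -> x i = x' i /\ W (i - 1) = W' (i - 1)) ->
  same_left_end (WalkS r a b' x' W') (WalkS r a b x W).
Proof.
move=> hc hx; rewrite /same_left_end /=; apply: (@splice_right_end _ _ _ _ _ _ _ _ (- c)).
  by move: hc; rewrite /inside; case: a => //= l; lia.
by move=> i ci; have [|-> ->] := hx (- i); first by lia.
Qed.

(** When [w] replaces [v] as a constituent, this preserves the [turn] at the wnode on its left. *)
Definition keeps_left (s : rank) v w : Prop :=
  wlo v = None -> wrank v = s -> wlo w = None /\ wrank w = s.

Definition keeps_right (s : rank) v w : Prop :=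
  whi v = None -> wrank v = s -> whi w = None /\ wrank w = s.

(** The wnode [y] takes the place of both terminal wnodes at index 0, which it embraces; the [turn]
    at [y] is the only new condition. *)
Lemma juxtapose r s a b (x x' : int -> N) W W' y : rank_pred r = Some s ->
  is_walk G (WalkS r a (Some 0) x W) -> is_walk G (WalkS r (Some 0) b x' W') ->
  inside a None (- 1) -> inside None b 1 ->
  wnodes G y -> rank_le (rk G y) r -> embraces G y (x 0) -> embraces G y (x' 0) ->
  turn G r s (W (- 1)) y (W' 0) ->
  is_walk G (WalkS r a b (fun i => if i < 0 then x i else if i == 0 then y else x' i)
                         (fun i => if i < 0 then W i else W' i)).
Proof.
move=> rs /(ranked_walkP _ _ _ _ _ rs)[rG _ n1 e1 t1].
move=> /(ranked_walkP _ _ _ _ _ rs)[_ _ n2 e2 t2] ha hb hy ry yx yx' ty.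
have L i : i <= 0 -> inside a b i -> inside a (Some 0) i.
  by move: ha hb; rewrite /inside; case: (a) => [?|]; case: (b) => [?|]; lia.
have R i : 0 <= i -> inside a b i -> inside (Some 0) b i.
  by move: ha hb; rewrite /inside; case: (a) => [?|]; case: (b) => [?|]; lia.
apply/(ranked_walkP _ _ _ _ _ rs); split => //.
- by exists 0; move: ha hb; rewrite /inside; case: (a) => [?|]; case: (b) => [?|]; lia.
- move=> i ii; case: ltP => i0; first by apply: n1; apply: L => //; lia.
  by case: eqP => // _; apply: n2; apply: R.
- move=> i i1 i2; case: ltP => i0.
    have i4 : i + 1 <= 0 by lia.
    have := e1 i (L _ (ltW i0) i1) (L _ i4 i2); case: ltP => i3 //; have -> : i + 1 = 0 by lia.
    rewrite eqxx; apply: link_embraces => //; exact: embraces_refl.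
  have i4 : 0 <= i + 1 by lia.
  have := e2 i (R _ i0 i1) (R _ i4 i2).
  have -> : (i + 1 < 0) = false by lia.
  have -> : (i + 1 == 0) = false by lia.
  case: eqP => // -> ; apply: link_embraces => //; exact: embraces_refl.
move=> i i1 i2 i3; case: (ltP i 0) => i0.
  have -> : i - 1 < 0 by lia.
  by apply: t1; apply: L => //; lia.
case: eqP => [->|ni0].
  have -> : (0 - 1 : int) < 0 by [].
  exact: ty.
have -> : (i - 1 < 0) = false by lia.
by apply: t2; apply: R => //; lia.
Qed.

(** The first walk ends at 1 and the second begins at 0, so that the two constituents to be merged
    both have index 0. The link [V] replaces them, and the turns at its two ends survive by
    [keeps_left] and [keeps_right]. *)
Lemma merge_links r s a b (x x' : int -> N) W W' V : rank_pred r = Some s ->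
  is_walk G (WalkS r a (Some 1) x W) -> is_walk G (WalkS r (Some 0) b x' W') ->
  inside a None 0 -> inside None b 1 ->
  link G s V (x 0) (x' 1) -> keeps_left s (W 0) V -> keeps_right s (W' 0) V ->
  is_walk G (WalkS r a b (fun i => if i <= 0 then x i else x' i)
     (fun i => if i < 0 then W i else if i == 0 then V else W' i)).
Proof.
move=> rs /(ranked_walkP _ _ _ _ _ rs)[rG _ n1 e1 t1].
move=> /(ranked_walkP _ _ _ _ _ rs)[_ _ n2 e2 t2] ha hb hV kl kr.
have L i : i <= 1 -> inside a b i -> inside a (Some 1) i.
  by move: ha hb; rewrite /inside; case: (a) => [?|]; case: (b) => [?|]; lia.
have R i : 0 <= i -> inside a b i -> inside (Some 0) b i.
  by move: ha hb; rewrite /inside; case: (a) => [?|]; case: (b) => [?|]; lia.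
have La : inside a (Some 1) 1 by move: ha; rewrite /inside; case: (a) => [?|]; lia.
have Rb : inside (Some 0) b 0 by move: hb; rewrite /inside; case: (b) => [?|]; lia.
apply/(ranked_walkP _ _ _ _ _ rs); split => //.
- by exists 0; move: ha hb; rewrite /inside; case: (a) => [?|]; case: (b) => [?|]; lia.
- move=> i ii; case: ifP => i0; first by apply: n1; apply: L => //; lia.
  by apply: n2; apply: R => //; lia.
- move=> i i1 i2; case: (ltP i 0) => i0.
    have -> : i <= 0 by lia.
    have -> : i + 1 <= 0 by lia.
    by apply: e1; apply: L => //; lia.
  have -> : (i + 1 <= 0) = false by lia.
  case: eqP => [->|ni0]; first by rewrite lexx add0r.
  have -> : (i <= 0) = false by lia.
  by apply: e2; apply: R => //; lia.
move=> i i1 i2 i3; case: (ltP i 0) => i0.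
  have -> : i - 1 < 0 by lia.
  have -> : i <= 0 by lia.
  by apply: t1; apply: L => //; lia.
case: (ltP (i - 1) 0) => i4.
  have ei : i = 0 by lia.
  subst i; rewrite eqxx lexx; have := t1 0 (L _ _ i1) (L _ _ i2).
  move=> /(_ ltac:(lia) ltac:(lia) ltac:(rewrite add0r; exact: La)) [h1 h2].
  split => //; case: h2; first by left.
  by move=> [/kl h3 /h3]; right.
have -> : (i <= 0) = false by lia.
have -> : (i == 0) = false by lia.
case: eqP => i5; last by apply: t2; apply: R => //; lia.
have ei : i = 1 by lia.
subst i; have := t2 1; rewrite subrr => /(_ Rb (R _ _ i2) (R _ _ i3)).
move=> /(_ ltac:(lia) ltac:(lia)) [h1 h2]; split => //; case: h2; last by right.
by move=> [/kr h3 /h3]; left.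
Qed.

Definition isum (f : int -> nat) (l : int) (n : nat) : nat := (\sum_(i < n) f (l + i%:Z)%R)%N.

Lemma isum_cat f l m n : isum f l (m + n) = (isum f l m + isum f (l + m%:Z) n)%N.
Proof.
rewrite /isum big_split_ord /=; congr addn.
by apply: eq_bigr => i _; rewrite PoszD addrA.
Qed.

Lemma eq_isum f g l n : (forall i : int, l <= i -> i < l + n%:Z -> f i = g i) ->
  isum f l n = isum g l n.
Proof. by move=> h; apply: eq_bigr => i _; apply: h; have := ltn_ord i; lia. Qed.

Lemma isum1 f l : isum f l 1 = f l.
Proof. by rewrite /isum big_ord1 addr0. Qed.

Lemma weight_walkS e r (l h : int) (x : int -> N) W :
  weight e (wlength (WalkS r (Some l) (Some h) x W)) =
  isum (fun i => weight e (wlength (W i))) l `|(h - l)%R|%N.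
Proof. exact: (weight_sum e _ (fun i => wlength (W (l + i%:Z)))). Qed.

Lemma isum_rev f (h : int) n : isum (fun i => f (- i - 1)) (- h) n = isum f (h - n%:Z) n.
Proof.
rewrite /isum (reindex_inj rev_ord_inj) /=; apply: eq_bigr => i _; congr f.
by have := ltn_ord i; move: (nat_of_ord i) => j; lia.
Qed.

Lemma walk_ends w l h : is_walk G w -> wlo w = Some l -> whi w = Some h -> l <= h.
Proof.
move=> hw; have [i] : exists i, winside w i by case: w hw => [a b x|r a b x W] [].
by rewrite /winside => + wl wh; rewrite wl wh /inside; lia.
Qed.

Lemma weight_rev e w : is_walk G w -> weight e (wlength (wrev w)) = weight e (wlength w).
Proof.
elim: w => [[l|] [h|] x|r [l|] [h|] x W IH] hw //.
  by rewrite /=; congr (weight e (cnf_mono _ `|_|)); lia.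
have lh := walk_ends hw erefl erefl.
rewrite -[wrev _]/(WalkS r (Some (- h)) (Some (- l)) (fun i => x (- i))
                    (fun i => wrev (W (- i - 1)))) !weight_walkS.
rewrite (isum_rev (fun i => weight e (wlength (wrev (W i))))).
have -> : `|(- l - - h)%R|%N = `|(h - l)%R|%N by lia.
have -> : h - `|(h - l)%R|%N%:Z = l by lia.
apply: eq_isum => i li ih; apply: IH; case: hw => _ _ _ hW _.
have i1 : inside (Some l) (Some h) i by rewrite /inside; lia.
have i2 : inside (Some l) (Some h) (i + 1) by rewrite /inside; lia.
by case: (hW i i1 i2).
Qed.

(** The induction statement. Since [y] has rank at most [s], no wtip of rank [s] lies at the
    junction; those at the outer ends are kept. *)
Definition concatenates (s : rank) : Prop := forall u v x y z,
  link G s u x y -> link G s v y z -> wnodes G x -> wnodes G y -> wnodes G z ->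
  rank_le (rk G y) s ->
  exists2 w, link G s w x z & keeps_left s u w /\ keeps_right s v w.

Hypothesis es : embracing_structure G.

Lemma embraces_wnodes x y : wnodes G x -> embraces G x y -> wnodes G y.
Proof.
move=> + xy; elim: xy => // a b c ab _ IH aG; apply: IH; exact: (es_elts es) ab.
Qed.

Lemma embraces_inv x y : embraces G x y ->
  x = y \/ exists2 z, elts G x z & embraces G z y.
Proof. by case=> [|z t xz zt]; [left|right; exists z]. Qed.

(** A terminal wnode of [w] has rank at most [s], so it is not [y] itself; a wtip that is an element
    of [y] has rank [s], which is excluded. Either way [y] is reached through one of its
    elements. *)
Lemma reaches_right_below r s w y : rank_pred r = Some s ->
  is_walk G w -> nontrivial w -> rank_le (wrank w) s -> wnodes G y -> rk G y = r ->
  reaches_right G w y -> ~ (whi w = None /\ wrank w = s) ->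
  exists2 z, elts G y z & reaches_right G w z.
Proof.
move=> rs hw [j [j1 j2]] ws yG yr; rewrite /reaches_right.
case E : (whi w) => [h|] yh nt; last first.
  case: yh => t [q yq tq] [v tv vw]; case: yq tq => [|c d yc cd] tq.
    exfalso; apply: nt; split => //; have := es_tips es yG tq tv.
    by rewrite yr rs => -[->]; case: vw.
  by exists c => //; exists t; [exists d|exists v].
have hh : winside w h.
  by move: j1; rewrite /winside E /inside; case: (wlo w) => [l|]; lia.
have [_ hr] := walk_node_rank hw hh.
case: (embraces_inv yh) => [yE|[c yc cd]]; last by exists c.
by have := rank_le_trans hr ws; rewrite -yE yr (rank_pred_lt _ rs) rank_ltxx.
Qed.

(** Juxtaposition adds the coefficients. Merging drops two constituents and inserts one, whose
    coefficient is at most 2 by [link_weight]: this is the origin of the error in the triangle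
    inequality. *)
Lemma concatenate_centered r s a b (x x' : int -> N) W W' y :
  rank_pred r = Some s -> concatenates s ->
  is_walk G (WalkS r a (Some 0) x W) -> is_walk G (WalkS r (Some 0) b x' W') ->
  nontrivial (WalkS r a (Some 0) x W) -> nontrivial (WalkS r (Some 0) b x' W') ->
  wnodes G y -> rank_le (rk G y) r -> embraces G y (x 0) -> embraces G y (x' 0) ->
  exists w, [/\ is_walk G w, nontrivial w, wrank w = r,
               same_left_end (WalkS r a (Some 0) x W) w /\
               same_right_end (WalkS r (Some 0) b x' W') w &
               two_ended (WalkS r a (Some 0) x W) -> two_ended (WalkS r (Some 0) b x' W') ->
               (weight (rank_expo r) (wlength w) <=
                weight (rank_expo r) (wlength (WalkS r a (Some 0%R) x W)) +
                weight (rank_expo r) (wlength (WalkS r (Some 0%R) b x' W')) + 2)%N].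
Proof.
move=> rs Cs hP hQ nP nQ yG yr yx yx'.
have ha : inside a None (- 1).
  by case: nP => i []; rewrite /winside /inside /=; case: (a) => [?|]; lia.
have hb : inside None b 1.
  by case: nQ => i []; rewrite /winside /inside /=; case: (b) => [?|]; lia.
have /(ranked_walkP _ _ _ _ _ rs) [_ _ nodeP linkP _] := hP.
have /(ranked_walkP _ _ _ _ _ rs) [_ _ nodeQ linkQ _] := hQ.
have a1 : inside a (Some 0) (- 1) by move: ha; rewrite /inside; case: (a) => [?|]; lia.
have a0 : inside a (Some 0) 0 by move: ha; rewrite /inside; case: (a) => [?|]; lia.
have b0 : inside (Some 0) b 0 by move: hb; rewrite /inside; case: (b) => [?|]; lia.
have b1 : inside (Some 0) b 1 by move: hb; rewrite /inside; case: (b) => [?|]; lia.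
have lP : link G s (W (- 1)) (x (- 1)) y.
  have := linkP (- 1); rewrite addNr => /(_ a1 a0).
  by apply: link_embraces => //; exact: embraces_refl.
have lQ : link G s (W' 0) y (x' 1).
  have := linkQ 0; rewrite add0r => /(_ b0 b1).
  by apply: link_embraces => //; exact: embraces_refl.
have [tn|ntn] := pselect (turn G r s (W (- 1)) y (W' 0)).
  have hR := juxtapose rs hP hQ ha hb yG yr yx yx' tn.
  set R := (X in is_walk G X) in hR; exists R; split => //.
  - exists 0; rewrite /R /winside /=; move: ha hb; rewrite /inside.
    by case: (a) => [?|]; case: (b) => [?|]; lia.
  - split; [apply: (@splice_left_end _ _ _ _ _ _ _ _ (-1))|apply: (@splice_right_end _ _ _ _ _ _ _ _ 1)] => // i i1.
      have -> : i < 0 by lia.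
      by have -> : i - 1 < 0 by lia.
    have -> : (i < 0) = false by lia.
    by have -> : (i == 0) = false by lia.
  case: (a) ha @R hR => [l|] ha; case: (b) hb => [h|] hb R hR [] // _ _ [] // _ _.
  move: ha hb; rewrite /inside => ha hb; rewrite /R !weight_walkS.
  have -> : `|(h - l)%R|%N = (`|(0 - l)%R|%N + `|(h - 0)%R|%N)%N by lia.
  rewrite isum_cat; have -> : l + `|(0 - l)%R|%N%:Z = 0 by lia.
  apply: leq_trans (leq_addr _ _); apply: leq_add; apply: eq_leq.
    by apply: eq_isum => i i1 i2; have -> : i < 0 by lia.
  by apply: eq_isum => i i1 i2; have -> : (i < 0) = false by lia.
(* If [y] has rank [r], both constituents reach an element of [y], and it is the same one because
   the exceptional element is unique. *)
have [e [eG er re le]] : exists e, [/\ wnodes G e, rank_le (rk G e) s,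
    reaches_right G (W (- 1)) e & reaches_left G (W' 0) e].
  case: lP lQ => p1 p2 p3 p4 p5 [q1 q2 q3 q4 q5].
  move: (yr); rewrite (rank_pred_le _ rs) => -[ys|yr']; first by exists y.
  have [|c yc rc] := reaches_right_below rs p1 p2 p5 yG yr' p4.
    by move=> h; apply: ntn; split => //; left.
  have rA : rk G y <> Arrow by rewrite yr' => rA; move: rs; rewrite rA.
  have [|||d yd rd] := reaches_right_below rs (is_walk_rev q1) _ _ yG yr' q3.
  - exact/nontrivial_rev.
  - by rewrite wrank_rev.
  - rewrite whi_rev wrank_rev => -[h1 h2]; apply: ntn; split => //; right.
    by split => //; case: (wlo (W' 0)) h1.
  have ecd := es_exceptional es yG rA yc yd; subst d.
  exists c; split => //; first exact: (es_elts es) yc.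
  by rewrite (rank_pred_lt _ rs) -yr'; apply: (es_lt es).
have [||||||V lV [kl kr]] := Cs (W (- 1)) (W' 0) (x (- 1)) e (x' 1).
- by case: lP => *; split.
- by case: lQ => *; split.
- by case: (nodeP _ a1).
- exact: eG.
- by case: (nodeQ _ b1).
- exact: er.
(* The shift by 1 moves the last constituent of the first walk from index -1 to index 0, as
   [merge_links] expects. *)
have hP1 := is_walk_shift 1 hP; rewrite /= add0r in hP1.
have ha1 : inside (oshift 1 a) None 0.
  by move: ha; rewrite /inside; case: (a) => //= l; lia.
have hR := merge_links rs hP1 hQ ha1 hb (V := V).
rewrite sub0r in hR; move: hR => /(_ lV kl kr) hR.
set R := (X in is_walk G X) in hR; exists R; split => //.
- exists 0; rewrite /R /winside /=; move: ha1 hb; rewrite /inside.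
  by case: (oshift 1 a) => [?|]; case: (b) => [?|]; lia.
- split.
    apply: same_left_end_trans (same_left_end_shift 1 _) _ => /=.
    apply: (@splice_left_end _ _ _ _ _ _ _ _ 0) => // i i1.
    by rewrite i1; have -> : i - 1 < 0 by lia.
  apply: (@splice_right_end _ _ _ _ _ _ _ _ 1) => // i i1.
  have -> : (i <= 0) = false by lia.
  have -> : (i < 0) = false by lia.
  by have -> : (i == 0) = false by lia.
have wV := link_weight rs lV.
rewrite -(wlength_shift 1 (WalkS r a _ _ _)).
case: (a) ha ha1 @R hR => [l|] ha ha1; case: (b) hb => [h|] hb R hR [] // _ _ [] // _ _.
move: ha hb; rewrite /inside => ha hb; rewrite /R [wshift _ _]/= [oshift _ _]/= !weight_walkS.
set f := fun i => _; set g := fun i => _; set g' := fun i => _.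
have -> : `|(h - (l + 1))%R|%N = (`|(- (l + 1))%R|%N + (1 + `|(h - 1)%R|%N))%N by lia.
have -> : `|(0 + 1 - (l + 1))%R|%N = (`|(- (l + 1))%R|%N + 1)%N by lia.
have -> : `|(h - 0)%R|%N = (1 + `|(h - 1)%R|%N)%N by lia.
rewrite !isum_cat; have -> : l + 1 + `|(- (l + 1))%R|%N%:Z = 0 by lia.
rewrite !isum1.
have -> : isum f (l + 1) `|(- (l + 1))%R|%N = isum g (l + 1) `|(- (l + 1))%R|%N.
  by apply: eq_isum => i i1 i2; rewrite /f; have -> : i < 0 by lia.
have -> : isum f (0 + 1%N%:Z) `|(h - 1)%R|%N = isum g' (0 + 1%N%:Z) `|(h - 1)%R|%N.
  apply: eq_isum => i i1 i2; rewrite /f; have -> : (i < 0) = false by lia.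
  by have -> : (i == 0) = false by lia.
have : (f 0 <= 2)%N by exact: wV.
clearbody f g g'; move: (f 0) (g 0) (g' 0) (isum g _ _) (isum g' _ _) => p q q' A B; clear; lia.
Qed.

End Splicing.

(** * Merging links of natural-number rank *)

Section Concatenation.
Variables (N : Type) (G : wgraph_data N).
Hypothesis es : embracing_structure G.
Implicit Types (u v w : pwalk N).

Lemma same_left_end_keeps s v w :
  wrank w = wrank v -> same_left_end v w -> keeps_left s v w.
Proof. by move=> vw h vN vs; split; [exact: same_left_end_None vN|rewrite vw]. Qed.

Lemma same_right_end_keeps s v w :
  wrank w = wrank v -> same_right_end v w -> keeps_right s v w.
Proof. by move=> vw h vN vs; split; [exact: same_right_end_None vN|rewrite vw]. Qed.

Lemma concatenate_ranked r s u v y h l :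
  rank_pred r = Some s -> concatenates G s ->
  is_walk G u -> nontrivial u -> wrank u = r -> whi u = Some h ->
  is_walk G v -> nontrivial v -> wrank v = r -> wlo v = Some l ->
  wnodes G y -> rank_le (rk G y) r ->
  embraces G y (wnode u h) -> embraces G y (wnode v l) ->
  exists w, [/\ is_walk G w, nontrivial w, wrank w = r,
               same_left_end u w /\ same_right_end v w &
               two_ended u -> two_ended v ->
               (weight (rank_expo r) (wlength w) <=
                weight (rank_expo r) (wlength u) +
                weight (rank_expo r) (wlength v) + 2)%N].
Proof.
move=> rs Cs hu nu ur uh hv nv vr vl yG yr yu yv.
have r0 w : is_walk G w -> wrank w = r -> exists a b x W, w = WalkS r a b x W.
  case: w => [a b x|r' a b x W] _ /= wr; last by subst r'; exists a, b, x, W.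
  by move: rs; rewrite -wr.
have [a [b [x [W E]]]] := r0 _ hu ur; subst u.
have [a' [b' [x' [W' E']]]] := r0 _ hv vr; subst v.
rewrite /= in uh vl; subst b a'.
have hu1 := is_walk_shift (- h) hu; have hv1 := is_walk_shift (- l) hv.
have nu1 := nontrivial_shift (- h) nu; have nv1 := nontrivial_shift (- l) nv.
rewrite [wshift _ _]/= subrr in hu1; rewrite [wshift _ _]/= subrr in hv1.
rewrite [wshift _ _]/= subrr in nu1; rewrite [wshift _ _]/= subrr in nv1.
have [||w [w1 w2 w3 [w4 w5] w6]] := concatenate_centered es rs Cs hu1 hv1 nu1 nv1 yG yr.
- by rewrite opprK add0r.
- by rewrite opprK add0r.
have su := same_left_end_shift (- h) (WalkS r a (Some h) x W).
have sv := same_right_end_shift (- l) (WalkS r (Some l) b' x' W').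
rewrite [wshift _ _]/= subrr in su; rewrite [wshift _ _]/= subrr in sv.
exists w; split => //.
  by split; [exact: same_left_end_trans w4|exact: same_right_end_trans w5].
move=> tu tv.
have lu := wlength_shift (- h) (WalkS r a (Some h) x W).
have lv := wlength_shift (- l) (WalkS r (Some l) b' x' W').
rewrite [wshift _ _]/= subrr in lu; rewrite [wshift _ _]/= subrr in lv.
rewrite -lu -lv; apply: w6.
  by case: tu => + _ /=; case: (a).
by case: tv => _ + /=; case: (b').
Qed.

(** The wnode [x] may have too high a rank to be a terminal wnode. It is replaced by the terminal
    wnode of [w], or by the wnode that has the wtip of [w] as an element. *)
Lemma right_end w x : is_walk G w -> nontrivial w -> wnodes G x ->
  reaches_right G w x -> exists y, [/\ wnodes G y, embraces G x y,
    reaches_right G w y &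
    rank_le (rk G y) (wrank w) \/ rank_pred (rk G y) = Some (wrank w)].
Proof.
move=> hw [j [j1 j2]] xG; rewrite /reaches_right; case E : (whi w) => [h|].
  move=> xh; exists (wnode w h).
  have hh : winside w h.
    by move: j1; rewrite /winside E /inside; case: (wlo w) => [l|]; lia.
  have [h1 h2] := walk_node_rank hw hh; split => //; last by left.
  exact: embraces_refl.
move=> [t [q xq tq] [v tv vw]]; have qG := embraces_wnodes es xG xq.
exists q; split => //.
  exists t; last by exists v.
  by exists q => //; exact: embraces_refl.
by right; rewrite (es_tips es qG tq tv); case: vw => _ _ ->.
Qed.

Lemma left_end w x : is_walk G w -> nontrivial w -> wnodes G x ->
  reaches_left G w x -> exists y, [/\ wnodes G y, embraces G x y,
    reaches_left G w y &
    rank_le (rk G y) (wrank w) \/ rank_pred (rk G y) = Some (wrank w)].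
Proof.
move=> hw nw xG xw; rewrite -(wrank_rev w); apply: right_end => //.
  exact: is_walk_rev.
exact/nontrivial_rev.
Qed.

(** Raises the rank of a walk without changing its length. *)
Definition one_link (r : rank) w (x y : N) : pwalk N :=
  WalkS r (Some 0) (Some 1) (fun i => if i <= 0 then x else y) (fun _ => w).

Lemma one_link_walk r s w x y : rank_pred r = Some s -> rank_le r (gr_rank G) ->
  wnodes G x -> rank_le (rk G x) r -> wnodes G y -> rank_le (rk G y) r ->
  link G s w x y -> is_walk G (one_link r w x y) /\ nontrivial (one_link r w x y).
Proof.
move=> rs rG xG xr yG yr hw; split; last by exists 0.
apply/(ranked_walkP _ _ _ _ _ rs); split => //.
- by exists 0.
- by move=> i _; case: ifP.
- move=> i i1 i2; have -> : i <= 0 by move: i1 i2; rewrite /inside; lia.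
  by have -> : (i + 1 <= 0) = false by move: i1 i2; rewrite /inside; lia.
by move=> i i1 i2 i3; move: i1 i2 i3; rewrite /inside; lia.
Qed.

Lemma wlength_one_link r w x y : wlength (one_link r w x y) = wlength w.
Proof.
have addc0 c : cnf_add c cnf0 = c.
  by apply: val_inj => /=; case: (cnf_exps c).
by rewrite /= big_ord_recl big_ord0 addc0.
Qed.

(** A walk of lower rank becomes the only constituent of a walk of rank [r], and [keeps_left] is
    vacuous. A walk of rank [r] stays as it is: it terminates on the right, since a wtip of rank [r]
    belongs to a wnode of rank above [r], which [y] cannot embrace. *)
Lemma raise_rank r s w x y : rank_pred r = Some s -> rank_le r (gr_rank G) ->
  link G r w x y -> wnodes G x -> wnodes G y -> rank_le (rk G y) r ->
  exists w', [/\ is_walk G w', nontrivial w', wrank w' = r,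
    (exists2 h, whi w' = Some h & embraces G y (wnode w' h)) &
    reaches_left G w' x /\ keeps_left r w w'].
Proof.
move=> rs rG [hw nw wx wy wr] xG yG yr.
move: (wr); rewrite (rank_pred_le _ rs) => -[ws|wr'].
  have [p [pG xp wp pr]] := left_end hw nw xG wx.
  have {}pr : rank_le (rk G p) r.
    case: pr => [pw|pw]; first exact: rank_le_trans wr.
    exact: rank_pred_mono pw rs ws.
  have [|h1 h2] := @one_link_walk r s w p y rs rG pG pr yG yr; first by split.
  exists (one_link r w p y); split => //.
    by exists 1 => //; exact: embraces_refl.
  split; first by rewrite /reaches_left /reaches_right.
  by move=> _ wr'; move: ws; rewrite wr' (rank_pred_lt _ rs) rank_ltxx.
exists w; split => //; move: wy; rewrite /reaches_right.
case: (whi w) => [h yh|]; first by exists h.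
move=> [t [q yq tq] [v tv [_ _ vw _]]]; exfalso.
have qG := embraces_wnodes es yG yq.
have qr := es_tips es qG tq tv; rewrite vw wr' in qr.
have : rank_le (rk G q) r.
  apply: rank_le_trans yr; elim: {tq qr qG} yq yG => [*|a b c ab _ IH aG].
    exact: rank_le_refl.
  have := IH (es_elts es aG ab) => /rank_le_trans; apply.
  by case/andP: (es_lt es aG ab).
have := rank_pred_lt r qr; rewrite rank_le_refl => /esym /andP[_ /negP]; exact.
Qed.

Lemma concatenates_succ r s : rank_pred r = Some s -> rank_le r (gr_rank G) ->
  concatenates G s -> concatenates G r.
Proof.
move=> rs rG Cs u v x y z lu lv xG yG zG yr.
have [u' [u1 u2 u3 [h u4 u5] [u6 u7]]] := raise_rank rs rG lu xG yG yr.
have [v' [v1 v2 v3 [l v4 v5] [v6 v7]]] := raise_rank rs rG (link_rev lv) zG yG yr.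
have v4' : wlo (wrev v') = Some (- l) by rewrite wlo_rev v4.
have [|||w [w1 w2 w3 [w4 w5] _]] :=
  concatenate_ranked rs Cs u1 u2 u3 u4 (is_walk_rev v1) _ _ v4' yG yr u5 _.
- exact/nontrivial_rev.
- by rewrite wrank_rev.
- by rewrite wnode_rev opprK.
exists w.
  split => //; first exact: reaches_left_same_end u1 u2 w4 u6.
    apply: (reaches_right_same_end _ _ w5 v6); first exact: is_walk_rev.
    exact/nontrivial_rev.
  by rewrite w3 rank_le_refl.
split.
  move=> uN ur; have [u8 _] := u7 uN ur; split => //.
  exact: same_left_end_None u8.
move=> vN vr; have [v8 _] : wlo v' = None /\ wrank v' = r.
  by apply: v7; rewrite ?wlo_rev ?wrank_rev ?vN.
split => //; apply: same_right_end_None w5 _.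
by rewrite whi_rev v8.
Qed.

Lemma rank0_elts x : wnode_of_rank G (Fin 0) x -> forall y, embraces G x y -> y = x.
Proof.
move=> [xG xr] y xy; case: (embraces_inv xy) => [->//|[z xz _]].
by have := es_lt es xG xz; rewrite xr; case: (rk G z) => [[|m]||].
Qed.

Lemma rank0_walk w : is_walk G w -> rank_le (wrank w) (Fin 0) ->
  exists a b x, w = Walk0 a b x.
Proof.
case: w => [a b x|r a b x W] hw; first by exists a, b, x.
case: r hw => //= -[|n] // hw _.
by case: hw => _ _ _ _ [].
Qed.

Lemma rank0_right_end w y : is_walk G w -> wnode_of_rank G (Fin 0) y ->
  reaches_right G w y -> exists2 h, whi w = Some h & wnode w h = y.
Proof.
move=> hw y0; rewrite /reaches_right; case: (whi w) => [h /(rank0_elts y0)|].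
  by exists h.
move=> [t [q /(rank0_elts y0) -> yt] [v tv _]].
by have := es_tips es y0.1 yt tv; rewrite y0.2.
Qed.

(** For 0-walks there is no condition at nonterminal 0-nodes, so they are joined directly and the
    coefficients add exactly. *)
Lemma concatenate0 a b (x x' : int -> N) :
  is_walk G (Walk0 a (Some 0) x) -> is_walk G (Walk0 (Some 0) b x') ->
  nontrivial (Walk0 a (Some 0) x) -> nontrivial (Walk0 (Some 0) b x') ->
  x 0 = x' 0 ->
  let w := Walk0 a b (fun i => if i <= 0 then x i else x' i) in
  [/\ is_walk G w, nontrivial w, same_left_end (Walk0 a (Some 0) x) w,
      same_right_end (Walk0 (Some 0) b x') w &
      two_ended (Walk0 a (Some 0) x) -> two_ended (Walk0 (Some 0) b x') ->
      weight (0%N, 0%N) (wlength w) =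
      (weight (0%N, 0%N) (wlength (Walk0 a (Some 0%R) x)) +
       weight (0%N, 0%N) (wlength (Walk0 (Some 0%R) b x')))%N].
Proof.
move=> [_ n1 e1] [_ n2 e2] nP nQ x0 w.
have ha : inside a None (- 1).
  by case: nP => i []; rewrite /winside /inside /=; case: (a) => [?|]; lia.
have hb : inside None b 1.
  by case: nQ => i []; rewrite /winside /inside /=; case: (b) => [?|]; lia.
have L i : i <= 0 -> inside a b i -> inside a (Some 0) i.
  by move: ha hb; rewrite /inside; case: (a) => [?|]; case: (b) => [?|]; lia.
have R i : 0 <= i -> inside a b i -> inside (Some 0) b i.
  by move: ha hb; rewrite /inside; case: (a) => [?|]; case: (b) => [?|]; lia.
have ab : inside a b 0 /\ inside a b (0 + 1).
  by move: ha hb; rewrite /inside; case: (a) => [?|]; case: (b) => [?|]; lia.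
split.
- split; first by exists 0; case: ab.
    move=> i ii; case: ifP => i0; first by apply: n1; apply: L.
    by apply: n2; apply: R => //; lia.
  move=> i i1 i2; case: (ltP i 0) => i0.
    have i3 : i + 1 <= 0 by lia.
    by rewrite i3 (ltW i0); apply: e1; apply: L => //; exact: ltW.
  have -> : (i + 1 <= 0) = false by lia.
  suff -> : (if i <= 0 then x i else x' i) = x' i.
    by apply: e2; apply: R => //; lia.
  by case: ifP => // i3; have -> : i = 0 by lia.
- by exists 0.
- rewrite /same_left_end /same_right_end /=; case: (a) ha => [l|] ha /=.
    by exists (- l) => //; rewrite opprK; move: ha; rewrite /inside => /andP[]; case: ifP => //; lia.
  split => //; exists 0, 0 => i i0; rewrite addr0.
  by have -> : - i <= 0 by lia.
- rewrite /same_right_end /=; case: (b) hb => [h|] hb /=.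
    exists h => //; move: hb; rewrite /inside => hb.
    by have -> : (h <= 0) = false by lia.
  split => //; exists 0, 1 => i i0; rewrite addr0.
  by have -> : (i <= 0) = false by lia.
case: (a) ha @w => [l|] ha; case: (b) hb => [h|] hb w [] // _ _ [] // _ _.
rewrite /w /= !weight_mono eqxx !mul1n; move: ha hb; rewrite /inside; lia.
Qed.

Lemma concatenate_rank0 u v y :
  is_walk G u -> nontrivial u -> wrank u = Fin 0 -> reaches_right G u y ->
  is_walk G v -> nontrivial v -> wrank v = Fin 0 -> reaches_left G v y ->
  wnode_of_rank G (Fin 0) y ->
  exists w, [/\ is_walk G w, nontrivial w, wrank w = Fin 0,
               same_left_end u w /\ same_right_end v w &
               two_ended u -> two_ended v ->
               weight (0%N, 0%N) (wlength w) =
               (weight (0%N, 0%N) (wlength u) + weight (0%N, 0%N) (wlength v))%N].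
Proof.
move=> hu nu ur uy hv nv vr vy y0.
have [h uh uhy] := rank0_right_end hu y0 uy.
have [l vl vly] := rank0_right_end (is_walk_rev hv) y0 vy.
have [|a [b [x E]]] := rank0_walk hu; first by rewrite ur.
have [|a' [b' [x' E']]] := rank0_walk hv; first by rewrite vr.
subst u v; rewrite /= in uh uhy vl vly; subst b.
have [c ca cl] : exists2 c, a' = Some c & l = - c.
  by case: (a') vl => // c [<-]; exists c.
subst a' l; rename c into a'.
rewrite opprK in vly.
have := is_walk_shift (- h) hu; have := is_walk_shift (- a') hv.
have := nontrivial_shift (- h) nu; have := nontrivial_shift (- a') nv.
rewrite [wshift _ _]/= [wshift (- h) _]/= !subrr => nv1 nu1 hv1 hu1.
have [|w1 w2 w3 w4 w5] := concatenate0 hu1 hv1 nu1 nv1.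
  by rewrite !opprK !add0r uhy vly.
have su := same_left_end_shift (- h) (Walk0 a (Some h) x).
have sv := same_right_end_shift (- a') (Walk0 (Some a') b' x').
have lu := wlength_shift (- h) (Walk0 a (Some h) x).
have lv := wlength_shift (- a') (Walk0 (Some a') b' x').
rewrite [wshift _ _]/= subrr in su; rewrite [wshift _ _]/= subrr in sv.
rewrite [wshift _ _]/= subrr in lu; rewrite [wshift _ _]/= subrr in lv.
set w := (X in is_walk G X) in w1; exists w; split => //.
  by split; [exact: same_left_end_trans w3|exact: same_right_end_trans w4].
move=> tu tv; rewrite -lu -lv; apply: w5.
  by case: tu => + _ /=; case: (a).
by case: tv => _ + /=; case: (b').
Qed.

Lemma concatenates0 : concatenates G (Fin 0).
Proof.
move=> u v x y z [u1 u2 u3 u4 u5] [v1 v2 v3 v4 v5] xG yG zG yr.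
have eq0 r : rank_le r (Fin 0) -> r = Fin 0 by case: r => [[|n]||].
have [w [w1 w2 w3 [w4 w5] _]] := concatenate_rank0 u1 u2 (eq0 _ u5) u4 v1 v2 (eq0 _ v5) v3
  (conj yG (eq0 _ yr)).
exists w.
  split => //; first exact: reaches_left_same_end u1 u2 w4 u3.
    exact: reaches_right_same_end v1 v2 w5 v4.
  by rewrite w3.
split; first by apply: same_left_end_keeps w4; rewrite w3 (eq0 _ u5).
by apply: same_right_end_keeps w5; rewrite w3 (eq0 _ v5).
Qed.

Lemma concatenates_fin n : rank_le (Fin n) (gr_rank G) -> concatenates G (Fin n).
Proof.
elim: n => [|n IH] h; first exact: concatenates0.
apply: (@concatenates_succ _ (Fin n)) => //; apply: IH.
by apply: rank_le_trans h => /=.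
Qed.

End Concatenation.

(** * Merging links of rank up to [Arrow] *)

Section ArrowConcatenation.
Variables (N : Type) (G : wgraph_data N).
Hypothesis es : embracing_structure G.
Hypothesis rG : rank_le Arrow (gr_rank G).
Implicit Types (u v w : pwalk N).

Let fin_rank n : rank_le (Fin n) (gr_rank G).
Proof. exact: rank_le_trans rG. Qed.

Lemma arrow_from_unbounded w l : arrow_from G w l ->
  forall k : nat, exists m n, [/\ rk G (wnode w (l + k%:Z)) = Fin m,
    rk G (wnode w (l + k%:Z + 1)) = Fin n.+1, (m < n.+1)%N, (k <= n)%N &
    whi (wpiece w (l + k%:Z)) = None /\ wrank (wpiece w (l + k%:Z)) = Fin n].
Proof.
move=> h; elim=> [|k [m [n [h1 h2 h3 h4 _]]]].
  have [|m [n [h1 h2 h3 h4 h5]]] := h (l + 0%:Z); first by lia.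
  by exists m, n.
have [|m' [n' [h1' h2' h3' h4' h5']]] := h (l + k.+1%:Z); first by lia.
exists m', n'; split => //.
have e : l + k.+1%:Z = l + k%:Z + 1 by lia.
by move: h1'; rewrite e h2 => -[mE]; move: h3'; rewrite -mE; lia.
Qed.

(* The wnodes of the Arrow-walk have unbounded ranks: from some wnode on, the
   next one has a rank above those of [x], [y], [u] and of the whole walk before
   it, and everything before it is merged into one constituent. *)
Lemma absorb_finite l (x' : int -> N) W' n u x y mx my :
  is_walk G (WalkS Arrow (Some l) None x' W') ->
  link G (Fin n) u x y -> wnodes G x -> wnodes G y ->
  rk G x = Fin mx -> rk G y = Fin my -> embraces G y (x' l) ->
  exists x1 W1, let w := WalkS Arrow (Some 0) None x1 W1 in
    [/\ is_walk G w, nontrivial w, x1 0 = x, arrow_from G w 0 &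
        same_right_end (WalkS Arrow (Some l) None x' W') w].
Proof.
move=> hv lu xG yG xr yr yx.
have [_ _ nv ev sv] := hv.
have unb := arrow_from_unbounded sv; rewrite /= in unb.
(* The rank of the constituent number [k0] is at least [k0], hence at least [n], [mx] and [my]. *)
pose k0 : nat := (n + mx + my)%N.
have [m0 [n0 [h1 h2 h3 h4 [h5 h6]]]] := unb k0.
have inl (i : int) : l <= i -> inside (Some l) None i by rewrite /inside; lia.
have nbound k : (k <= k0)%N -> forall m, rk G (x' (l + k%:Z)) = Fin m -> (m <= n0)%N.
  move=> kk0; have up j : exists m', rk G (x' (l + (k + j)%N%:Z)) = Fin m' /\
      forall m, rk G (x' (l + k%:Z)) = Fin m -> (m <= m')%N.
    elim: j => [|j [m' [e1 e2]]].
      have [m [q [g1 _ _ _ _]]] := unb k; exists m; rewrite addn0 g1.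
      by split => // p [->].
    have [p [q [g1 g2 g3 g4 _]]] := unb (k + j)%N.
    have e : l + (k + j)%N%:Z + 1 = l + (k + j.+1)%N%:Z by lia.
    exists q.+1; rewrite -e g2; split => // m /e2.
    by move: e1; rewrite g1 => -[pm]; lia.
  have [m' [e1 e2]] := up (k0 - k)%N; move: e1; rewrite subnKC // h1 => -[e1] m /e2.
  by rewrite -e1; lia.
have lW k : (k <= k0)%N ->
    link G (Fin n0) (W' (l + k%:Z)) (x' (l + k%:Z)) (x' (l + k%:Z + 1)).
  move=> kk0; have [||g1 g2 g3 g4] := ev (l + k%:Z); try by apply: inl; lia.
  split => //; have [p [q [q1 q2 q3 q4 [q5 ->]]]] := unb k; rewrite /=.
  move: kk0; rewrite leq_eqVlt => /orP[/eqP kE|kk0].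
    by move: h2; rewrite -kE q2 => -[->].
  have := nbound k.+1 kk0 q.+1; have -> : l + k.+1%:Z = l + k%:Z + 1 by lia.
  by move=> /(_ q2); lia.
(* The constituents are merged one by one. [keeps_right] passes the right wtip of the last one to
   the merged link, which has to arrive at the next wnode through it. *)
have chain k : (k <= k0)%N -> exists2 w, link G (Fin n0) w x (x' (l + k%:Z + 1)) &
    keeps_right (Fin n0) (W' (l + k%:Z)) w.
  elim: k => [|k IH] kk0.
    have lu0 : link G (Fin n0) u x y by apply: link_le lu => /=; rewrite /k0 in h4; lia.
    have lW0 : link G (Fin n0) (W' (l + 0%:Z)) y (x' (l + 0%:Z + 1)).
      apply: link_embraces (lW 0%N _) => //; last exact: embraces_refl.
      by rewrite addr0.
    have [||w lw [_ kw]] := concatenates_fin es (fin_rank n0) lu0 lW0 xG yG.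
    - by apply: nv; apply: inl; lia.
    - by rewrite yr /=; rewrite /k0 in h4; lia.
    by exists w.
  have [w lw _] := IH (ltnW kk0).
  have e : l + k%:Z + 1 = l + k.+1%:Z by lia.
  rewrite e in lw; have [p [q [q1 _ _ _ _]]] := unb k.+1.
  have [|||w' lw' [_ kw']] := concatenates_fin es (fin_rank n0) lw (lW _ kk0) xG.
  - by apply: nv; apply: inl; lia.
  - by apply: nv; apply: inl; lia.
  - by rewrite q1; apply: nbound q1.
  by exists w'.
have [w lw kw] := chain k0 (leqnn _).
have [wN wr] := kw h5 h6.
pose c := l + k0%:Z.
(* Index 0 carries [x] and the merged link; index 1 is the old wnode following the constituent
   number [k0]. *)
exists (fun i => if i <= 0 then x else x' (i + c)), (fun i => if i <= 0 then w else W' (i + c)).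
have af : arrow_from G (WalkS Arrow (Some 0) None (fun i => if i <= 0 then x else x' (i + c))
    (fun i => if i <= 0 then w else W' (i + c))) 0.
  move=> i i0 /=; have -> : (i + 1 <= 0) = false by lia.
  case: ifP => i1.
    exists mx, n0; split => //; last by rewrite /k0 in h4; lia.
    by have -> : i + 1 + c = l + k0%:Z + 1 by rewrite /c; lia.
  have -> : i + 1 + c = i + c + 1 by lia.
  by apply: sv; rewrite /c; lia.
split => //.
- split => //; first by exists 0.
    by move=> i ii; case: ifP => // i0; apply: nv; apply: inl; rewrite /c; lia.
  move=> i i1 i2; have -> : (i + 1 <= 0) = false by move: i1; rewrite /inside; lia.
  case: ifP => i0.
    have -> : i + 1 + c = l + k0%:Z + 1 by move: i1; rewrite /inside /c; lia.
    by case: lw.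
  have -> : i + 1 + c = i + c + 1 by lia.
  by apply: ev; apply: inl; move: i1; rewrite /inside /c; lia.
- by exists 0.
rewrite /same_right_end /=; split => //; exists (- c), (c + 1) => i ci.
have -> : (i - c <= 0) = false by lia.
by rewrite subrK.
Qed.

(** The rank of [x] is arbitrary. As [u] has natural-number rank, it ends on the left at, or through
    a wtip of, a wnode of natural-number rank embraced by [x], and this wnode becomes the start of
    the new walk. *)
Lemma absorb_link l (x' : int -> N) W' n u x y my :
  is_walk G (WalkS Arrow (Some l) None x' W') ->
  link G (Fin n) u x y -> wnodes G x -> wnodes G y ->
  rk G y = Fin my -> embraces G y (x' l) ->
  exists w, [/\ is_walk G w, nontrivial w, wrank w = Arrow, reaches_left G w x &
    same_right_end (WalkS Arrow (Some l) None x' W') w].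
Proof.
move=> hv [h1 h2 h3 h4 h5] xG yG yr yx.
have [p [pG xp up pr]] := left_end es h1 h2 xG h3.
have [q uq] : exists q, wrank u = Fin q by case: (wrank u) h5 => // q; exists q.
have [m pm] : exists m, rk G p = Fin m.
  case: pr; rewrite uq; first by case: (rk G p) => // m; exists m.
  by case: (rk G p) => // m _; exists m.
have lu : link G (Fin n) u p y by split.
have [x1 [W1 [w1 w2 w3 w4 w5]]] := absorb_finite hv lu pG yG pm yr yx.
exists (WalkS Arrow (Some 0) None x1 W1); split => //.
by rewrite /reaches_left /reaches_right /= oppr0 w3.
Qed.

(** An [Arrow]-wnode has no wtips among its elements and is never a wnode of a walk of rank at most
    [Arrow], since the wnodes of an [Arrow]-walk have natural-number ranks. *)
Lemma reaches_right_in_chain w y : is_walk G w -> nontrivial w ->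
  rank_le (wrank w) Arrow -> wnode_of_rank G Arrow y -> reaches_right G w y ->
  exists2 z, elts G y z & reaches_right G w z.
Proof.
move=> hw [j [j1 j2]] wA [yG yA]; rewrite /reaches_right.
case E : (whi w) => [h|]; last first.
  move=> [t [q yq tq] [v tv vw]]; case: (embraces_inv yq) => [yE|[z yz zq]].
    by subst q; have := es_tips es yG tq tv; rewrite yA.
  by exists z => //; exists t; [exists q|exists v].
have hh : winside w h.
  by move: j1; rewrite /winside E /inside; case: (wlo w) => [l|]; lia.
move=> yh; case: (embraces_inv yh) => [yE|[z yz zh]]; last by exists z.
exfalso; have [_] := walk_node_rank hw hh; rewrite -yE yA.
case: w hw wA hh yE {E j1 j2 yh} => [//|r a b x W] hw wA hh yE.
case: r hw wA hh yE => // hw _ hh yE _.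
by have [m] := arrow_walk_node hw hh; rewrite -[x h]/(wnode (WalkS Arrow a b x W) h) -yE yA.
Qed.

(** Wtips of rank [Arrow] are elements of wnodes of rank [Omega] only, so the walk terminates at
    [y]; being of rank [Arrow], it is then infinite on the left. *)
Lemma arrow_walk_right_end w y m : is_walk G w -> wrank w = Arrow ->
  wnodes G y -> rk G y = Fin m -> reaches_right G w y ->
  exists h x W, w = WalkS Arrow None (Some h) x W /\ embraces G y (x h).
Proof.
move=> hw wA yG yr; case: w hw wA => // r a b x W hw /= rA; subst r.
rewrite /reaches_right /=; case: b hw => [h|] hw yh; last first.
  case: yh => t [q yq tq] [v tv [_ _ vA _]]; exfalso.
  have qG := embraces_wnodes es yG yq.
  have := es_tips es qG tq tv; rewrite vA /=.
  suff : rank_le (rk G q) (Fin m) by case: (rk G q) => [[|n]||].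
  rewrite -yr; elim: {tq qG yr} yq yG => [*|a' b c ab _ IH aG].
    exact: rank_le_refl.
  have := IH (es_elts es aG ab) => /rank_le_trans; apply.
  by case/andP: (es_lt es aG ab).
exists h, x, W; split => //.
by case: a hw => // l [].
Qed.

(** The terminal wnodes may differ, both being merely embraced by [y]. The right-hand walk absorbs
    the last constituent of the left-hand one, after which the two share the wnode [x1 0], from
    which the ranks increase in both directions. *)
Lemma join_arrows h (x : int -> N) W l x' W' y my :
  is_walk G (WalkS Arrow None (Some h) x W) -> is_walk G (WalkS Arrow (Some l) None x' W') ->
  wnodes G y -> rk G y = Fin my -> embraces G y (x h) -> embraces G y (x' l) ->
  exists w, [/\ is_walk G w, nontrivial w, wrank w = Arrow,
     same_left_end (WalkS Arrow None (Some h) x W) w &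
     same_right_end (WalkS Arrow (Some l) None x' W') w].
Proof.
move=> hu hv yG yr yx yx'.
have hu1 := is_walk_shift (1 - h) hu.
have su := same_left_end_shift (1 - h) (WalkS Arrow None (Some h) x W).
have eh : h + (1 - h) = 1 by lia.
rewrite [wshift _ _]/= eh in hu1; rewrite [wshift _ _]/= eh in su.
have yx1 : embraces G y (x (1 - (1 - h))) by have -> : 1 - (1 - h) = h by lia.
move: hu1 su yx1; set x1 := fun i : int => x _; set W1 := fun i : int => W _.
rewrite -[x (1 - (1 - h))]/(x1 1) => hu1 su yx1.
have [_ _ n1 e1 s1] := hu1.
rewrite /arrow_shape [wlo _]/= [whi _]/= in s1.
have ins (i : int) : i <= 1 -> inside None (Some 1) i by [].
have [m [n [r0 r1 mn h4 h5]]] := s1 (- 1) (lexx _).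
rewrite /= !opprK in r0 r1 h4 h5; rewrite addNr oppr0 in r1.
have l0 : link G (Fin n) (W1 0) (x1 0) y.
  have [||g1 g2 g3 g4] := e1 0; try by apply: ins; lia.
  split => //.
    by apply: reaches_right_embraces g4; rewrite add0r.
  by move: h5; rewrite wrank_rev subrr => ->; rewrite /= leqnn.
have [x2 [W2 [w1 w2 w3 w4 w5]]] := absorb_finite hv l0 (n1 0 (ins 0 ltac:(lia))) yG r1 yr yx'.
have [_ _ n2 e2 _] := w1.
pose x3 i := if i <= 0 then x1 i else x2 i.
pose W3 i := if i < 0 then W1 i else W2 i.
exists (WalkS Arrow None None x3 W3); split => //.
- split => //; first by exists 0.
  + by move=> i _; rewrite /x3; case: ifP => i0; [apply: n1; apply: ins; lia|apply: n2; rewrite /inside; lia].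
  + move=> i _ _; rewrite /x3 /W3; case: (ltP i 0) => i0.
      have -> : i <= 0 by lia.
      have -> : i + 1 <= 0 by lia.
      by apply: e1; apply: ins; lia.
    have -> : (i + 1 <= 0) = false by lia.
    have -> : (if i <= 0 then x1 i else x2 i) = x2 i.
      by case: ifP => // i1; rewrite (_ : i = 0) ?w3 //; lia.
    by apply: e2; rewrite /inside; lia.
  exists 0; split.
    move=> i i0 /=; have := w4 i i0; rewrite /= /x3 /W3.
    have -> : (i + 1 <= 0) = false by lia.
    have -> : (i < 0) = false by lia.
    by case: ifP => // i1; rewrite (_ : i = 0) ?w3 //; lia.
  move=> i; rewrite oppr0 => i0; have := s1 i; rewrite /= /x3 /W3.
  have -> : - i <= 0 by lia.
  have -> : - (i + 1) <= 0 by lia.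
  have -> : - i - 1 < 0 by lia.
  by apply; lia.
- by exists 0.
- apply: same_left_end_trans su _; apply: (@splice_left_end _ _ _ _ _ _ _ _ _ 0) => // i i0.
  by rewrite /x3 /W3 i0; have -> : i - 1 < 0 by lia.
apply: same_right_end_trans w5 _; apply: (@splice_right_end _ _ _ _ _ _ _ _ _ 1) => // i i0.
rewrite /x3 /W3; have -> : (i <= 0) = false by lia.
by have -> : (i < 0) = false by lia.
Qed.

Lemma concatenates_arrow : concatenates G Arrow.
Proof.
move=> u v x y z lu lv xG yG zG yA.
(* If [y] has rank [Arrow], both links reach members of its chain; the larger of the two members is
   reached by both and can replace [y]. *)
wlog [my yr] : y lu lv yG yA / exists my, rk G y = Fin my.
  move=> wl; case yr : (rk G y) yA => [my||] // _.
    by apply: (wl y); rewrite ?yr //; exists my.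
  have y0 : wnode_of_rank G Arrow y by [].
  have [c yc uc] : exists2 c, elts G y c & reaches_right G u c.
    by case: lu => *; apply: reaches_right_in_chain.
  have [d yd vd] : exists2 d, elts G y d & reaches_right G (wrev v) d.
    case: (link_rev lv) => ? ? ? ? ?; exact: reaches_right_in_chain.
  have [c' [yc' uc' vc']] : exists c', [/\ elts G y c', reaches_right G u c' & reaches_left G v c'].
    case: (es_arrow es y0 yc yd) => cd; [exists c|exists d]; split => //.
      exact: reaches_left_embraces vd.
    exact: reaches_right_embraces uc.
  have [m cm] : exists m, rk G c' = Fin m.
    have := es_lt es yG yc'; rewrite yr; case: (rk G c') => // m _; by exists m.
  apply: (wl c').
  - by case: lu => *; split.
  - by case: lv => *; split.
  - exact: es_elts yc'.
  - by rewrite cm.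
  - by exists m.
have finite w : rank_le (wrank w) Arrow -> wrank w <> Arrow -> exists n, wrank w = Fin n.
  by case: (wrank w) => // n; exists n.
have [u1 u2 u3 u4 u5] := lu; have [v1 v2 v3 v4 v5] := lv.
have rv1 := is_walk_rev v1; have /nontrivial_rev rv2 := v2.
have rvA : wrank (wrev v) = wrank v by rewrite wrank_rev.
have rightv : wrank v = Arrow -> exists l x' W',
    v = WalkS Arrow (Some l) None x' W' /\ embraces G y (x' l).
  rewrite -rvA => vA; have [h [x' [W' [E yh]]]] := arrow_walk_right_end rv1 vA yG yr v3.
  exists (- h), (fun i => x' (- i)), (fun i => wrev (W' (- i - 1))).
  by rewrite -(wrevK v) E /= opprK.
(* Two [Arrow]-walks are joined, one absorbs the other link, or both have natural-number ranks and
   are merged at a common rank. On a side without an [Arrow]-walk there is nothing to keep. *)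
have [uA|/(finite _ u5)[n un]] := pselect (wrank u = Arrow);
  have [vA|/(finite _ v5)[p vp]] := pselect (wrank v = Arrow).
- have [h [x1 [W1 [uE yx1]]]] := arrow_walk_right_end u1 uA yG yr u4.
  have [l [x2 [W2 [vE yx2]]]] := rightv vA.
  have hu := u1; have hv := v1; rewrite uE in hu; rewrite vE in hv.
  have [w [w1 w2 w3]] := join_arrows hu hv yG yr yx1 yx2.
  rewrite -uE -vE => w4 w5; exists w.
    split => //; first exact: reaches_left_same_end u1 u2 w4 u3.
      exact: reaches_right_same_end v1 v2 w5 v4.
    by rewrite w3.
  by split; [apply: same_left_end_keeps w4|apply: same_right_end_keeps w5]; rewrite w3.
- have [h [x1 [W1 [uE yx1]]]] := arrow_walk_right_end u1 uA yG yr u4.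
  have lv' : link G (Fin p) (wrev v) z y.
    by case: (link_rev lv) => *; split => //; rewrite rvA vp /=.
  have hu := is_walk_rev u1; rewrite uE /= in hu.
  have [|w [w1 w2 w3 w4 w5]] := absorb_link hu lv' zG yG yr; first by rewrite opprK.
  have {}w5 : same_left_end u (wrev w) by rewrite /same_left_end wrevK uE.
  exists (wrev w).
    split; first exact: is_walk_rev.
    + exact/nontrivial_rev.
    + exact: reaches_left_same_end u1 u2 w5 u3.
    + by rewrite reaches_right_rev.
    + by rewrite wrank_rev w3.
  split; first by apply: same_left_end_keeps w5; rewrite wrank_rev w3.
  by move=> _; rewrite vp.
- have [l [x2 [W2 [vE yx2]]]] := rightv vA.
  have lu' : link G (Fin n) u x y by split => //; rewrite un /=.
  have hv := v1; rewrite vE in hv.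
  have [w [w1 w2 w3 w4]] := absorb_link hv lu' xG yG yr yx2.
  rewrite -vE => w5; exists w.
    split => //; first exact: reaches_right_same_end v1 v2 w5 v4.
    by rewrite w3.
  split; first by move=> _; rewrite un.
  by apply: same_right_end_keeps w5; rewrite w3.
pose q := maxn (maxn n p) my.
have [|||w lw _] := @concatenates_fin _ _ es q (fin_rank q) u v x y z _ _ xG yG zG.
- by split => //; rewrite un /= /q; lia.
- by split => //; rewrite vp /= /q; lia.
- by rewrite yr /= /q; lia.
exists w; first exact: link_le lw.
by split; move=> _; rewrite ?un ?vp.
Qed.

End ArrowConcatenation.

Lemma concatenates_pred (N : Type) (G : wgraph_data N) r s :
  embracing_structure G -> rank_le r (gr_rank G) -> rank_pred r = Some s ->
  concatenates G s.
Proof.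
move=> es rG rs; have sG : rank_le s (gr_rank G).
  by apply: rank_le_trans rG; rewrite (rank_pred_le _ rs); left; exact: rank_le_refl.
case: r rs {rG} => [[|n]||] //= [sE]; subst s; first exact: concatenates_fin.
exact: concatenates_arrow.
Qed.

(** * Embracing in wgraphs and wsections *)

Lemma bounded_maximal (N : Type) (G : wgraph_data N) n x :
  (forall y, wnodes G y -> rank_le (rk G y) (Fin n)) -> wnodes G x ->
  exists2 y, is_maximal_wnode G y & embraces G y x.
Proof.
move=> bn xG; apply: contrapT => nm.
have up k : exists y m, [/\ wnodes G y, embraces G y x, rk G y = Fin m & (k <= m)%N].
  elim: k => [|k [y [m [yG yx ym km]]]].
    have := bn x xG; case xr : (rk G x) => [m||] // _.
    by exists x, m; split => //; exact: embraces_refl.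
  have : ~ is_maximal_wnode G y by move=> ym'; apply: nm; exists y.
  rewrite /is_maximal_wnode => /not_andP[//|/existsNP[z]].
  move=> /not_implyP[zG /not_implyP[zy /negP]]; rewrite negbK ym => yz.
  have := bn z zG; case zr : (rk G z) yz => [p||] // + _.
  rewrite /rank_lt /= => /andP[_ mp]; exists z, p; split => //; last by lia.
  exact: embraces_trans zy yx.
have [y [m [yG _ ym nm']]] := up n.+1.
by have := bn y yG; rewrite ym /=; lia.
Qed.

Section WgraphStructure.
Variables (N : Type) (G : wgraph_data N).
Hypothesis hG : is_wgraph G.
Implicit Types x y z : N.

Lemma embraces_last x y : embraces G x y -> x = y \/
  exists2 z, embraces G x z & elts G z y.
Proof.
move=> /(Operators_Properties.clos_rt1n_rt N (elts G)) /(Operators_Properties.clos_rt_rtn1 N (elts G)) [|z w zw xz]; first by left.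
by right; exists z => //; apply/Operators_Properties.clos_rt_rt1n/Operators_Properties.clos_rtn1_rt.
Qed.

Definition chain_sequence (s : nat -> N) : Prop :=
  [/\ forall i, exists n, wnode_of_rank G (Fin n) (s i),
      forall i, rank_lt (rk G (s i)) (rk G (s i.+1)) &
      forall i, elts G (s i.+1) (s i)].

Lemma chain_sequenceE c : is_chain G c <-> exists2 s, chain_sequence s & c = range s.
Proof. by split => [[s [h1 h2 h3 ->]]|[s [h1 h2 h3] ->]]; exists s. Qed.

Lemma chain_sequence_wnode s i : chain_sequence s ->
  wnodes G (s i) /\ rk G (s i) <> Arrow.
Proof. by move=> [h _ _]; have [n [sG sr]] := h i; rewrite sr. Qed.

Lemma chain_sequence_embraces s i j : chain_sequence s -> (i <= j)%N ->
  embraces G (s j) (s i).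
Proof.
move=> [_ _ h]; elim: j => [|j IH]; first by rewrite leqn0 => /eqP ->; exact: embraces_refl.
rewrite leq_eqVlt => /orP[/eqP ->|/IH]; first exact: embraces_refl.
exact: embraces_elts.
Qed.

(** Upwards, a wnode is the exceptional element of at most one wnode outside rank [Arrow];
    downwards, the exceptional element is unique. *)
Lemma chain_sequence_align s s' i j : chain_sequence s -> chain_sequence s' ->
  s i = s' j -> (forall k, s (i + k)%N = s' (j + k)%N) /\
  (forall k, (k <= i)%N -> (k <= j)%N -> s (i - k)%N = s' (j - k)%N).
Proof.
move=> cs cs' e; have [_ _ h] := cs; have [_ _ h'] := cs'; split.
  elim=> [|k IH]; first by rewrite !addn0.
  rewrite !addnS.
  have [g1 g2] := chain_sequence_wnode (i + k).+1 cs.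
  have [g1' g2'] := chain_sequence_wnode (j + k).+1 cs'.
  apply: (wg_exceptional_inj hG g1 g2 g1' g2') (h _) _.
  by rewrite IH; exact: h'.
elim=> [|k IH] ki kj; first by rewrite !subn0.
have {}IH := IH (ltnW ki) (ltnW kj).
have [g1 g2] := chain_sequence_wnode (i - k) cs.
apply: ((wg_exceptional hG g1 g2).2).
  have -> : (i - k = (i - k.+1).+1)%N by lia.
  exact: h.
rewrite IH; have -> : (j - k = (j - k.+1).+1)%N by lia.
exact: h'.
Qed.

Lemma chain_sequence_range s s' i j : chain_sequence s -> chain_sequence s' ->
  s i = s' j -> (i <= j)%N -> range s `<=` range s'.
Proof.
move=> cs cs' e ij _ [n _ <-]; have [up dn] := chain_sequence_align cs cs' e.
have [ni|ni] := leqP i n.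
  by exists (j + (n - i))%N => //; rewrite -up subnKC.
exists (j - (i - n))%N => //; rewrite -dn; try lia.
by congr s; lia.
Qed.

Lemma arrow_chain a : wnode_of_rank G Arrow a ->
  exists2 s, chain_sequence s & elts G a = range s.
Proof. by move=> /(wg_arrow hG)[_ [/chain_sequenceE]]. Qed.

(** Two chains with a common member are nested, so maximality makes them equal, and a maximal chain
    belongs to a single [Arrow]-wnode. *)
Lemma arrow_elts_inj a b x : wnode_of_rank G Arrow a -> wnode_of_rank G Arrow b ->
  elts G a x -> elts G b x -> a = b.
Proof.
move=> a0 b0 ax bx.
have rA : rank_le Arrow (gr_rank G) by rewrite -a0.2; apply: (wg_rank hG); exact: a0.1.
suff E : elts G a = elts G b.
  have [_ mb] := wg_arrow hG b0.
  have [c [_ cu]] := wg_arrow_all hG rA mb.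
  by rewrite -(cu a) // -(cu b).
wlog : a b a0 b0 ax bx / exists s s' i j, [/\ chain_sequence s, chain_sequence s',
    elts G a = range s, elts G b = range s' & s i = x /\ s' j = x /\ (i <= j)%N].
  move=> wl; have [s cs sE] := arrow_chain a0; have [s' cs' sE'] := arrow_chain b0.
  have [i _ ix] : range s x by rewrite -sE.
  have [j _ jx] : range s' x by rewrite -sE'.
  have [ij|/ltnW ji] := leqP i j; first by apply: wl => //; exists s, s', i, j.
  by apply/esym; apply: wl => //; exists s', s, j, i.
move=> [s [s' [i [j [cs cs' sE sE' [ix [jx ij]]]]]]].
have [_ [_ mx]] := wg_arrow hG a0.
apply/esym/mx; first by rewrite sE'; apply/chain_sequenceE; exists s'.
rewrite sE sE'; apply: (chain_sequence_range cs cs' _ ij).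
by rewrite ix.
Qed.

(** An [Arrow]-wnode has its whole chain as elements, so [x] may also be the exceptional element of
    the next wnode in that chain, which is then an element of the [Arrow]-wnode. Otherwise the two
    wnodes are equal. *)
Lemma elts_comparable a b x : wnodes G a -> wnodes G b -> elts G a x -> elts G b x ->
  [\/ a = b, elts G a b | elts G b a].
Proof.
have mixed a' b' : wnode_of_rank G Arrow a' -> wnodes G b' -> rk G b' <> Arrow ->
    elts G a' x -> elts G b' x -> elts G a' b'.
  move=> a0 bG bA; have [s cs ->] := arrow_chain a0; move=> [i _ <-] bx.
  have [g1 g2] := chain_sequence_wnode i.+1 cs; have [_ _ h] := cs.
  by exists i.+1 => //; apply: (wg_exceptional_inj hG g1 g2 bG bA) (h _) bx.
move=> aG bG ax bx; have [aA|aA] := pselect (rk G a = Arrow);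
  have [bA|bA] := pselect (rk G b = Arrow).
- by apply: Or31; apply: arrow_elts_inj ax bx.
- by apply: Or32; apply: mixed ax bx.
- by apply: Or33; apply: mixed bx ax.
by apply: Or31; apply: (wg_exceptional_inj hG aG aA bG bA) ax bx.
Qed.

Lemma wgraph_embraces_wnodes x y : wnodes G x -> embraces G x y -> wnodes G y.
Proof. by move=> + xy; elim: xy => // a b c ab _ IH aG; apply/IH/(wg_elts hG aG ab). Qed.

Lemma elts_embraces_comparable a b x : wnodes G a -> wnodes G b ->
  elts G a x -> embraces G b x -> embraces G a b \/ embraces G b a.
Proof.
move=> aG bG + /(Operators_Properties.clos_rt1n_rt N (elts G)) /(Operators_Properties.clos_rt_rtn1 N (elts G)) bx.
have toE y : clos_refl_trans_n1 N (elts G) b y -> embraces G b y.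
  by move=> h; apply/Operators_Properties.clos_rt_rt1n/Operators_Properties.clos_rtn1_rt.
elim: bx => [ab|d y dy bd IH ay].
  by left; apply: embraces_elts ab _; exact: embraces_refl.
have dG := wgraph_embraces_wnodes bG (toE _ bd).
case: (elts_comparable aG dG ay dy) => [->|/IH //|da]; first by right; apply: toE.
right; apply: embraces_trans (toE _ bd) _.
by apply: embraces_elts da _; exact: embraces_refl.
Qed.

(** Above a wnode there is only one way up, by [elts_comparable]. The induction climbs from the
    lower end of the embracing, whence the passage to [clos_refl_trans_n1]. *)
Lemma embraces_comparable a b x : wnodes G a -> wnodes G b ->
  embraces G a x -> embraces G b x -> embraces G a b \/ embraces G b a.
Proof.
move=> aG bG /(Operators_Properties.clos_rt1n_rt N (elts G)) /(Operators_Properties.clos_rt_rtn1 N (elts G)) ax.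
have toE y : clos_refl_trans_n1 N (elts G) a y -> embraces G a y.
  by move=> h; apply/Operators_Properties.clos_rt_rt1n/Operators_Properties.clos_rtn1_rt.
elim: ax => [|c y cy ac IH by_]; first by right.
have cG := wgraph_embraces_wnodes aG (toE _ ac).
case: (elts_embraces_comparable cG bG cy by_) => [cb|//].
by left; apply: embraces_trans (toE _ ac) cb.
Qed.

Lemma wgraph_elts_lt x y : wnodes G x -> elts G x y -> rank_lt (rk G y) (rk G x).
Proof.
move=> xG; have [xA|xA] := pselect (rk G x = Arrow); last exact: (wg_exceptional hG xG xA).1.
have [s cs ->] := arrow_chain (conj xG xA); rewrite xA => -[i _ <-].
by have [h _ _] := cs; have [n [_ ->]] := h i.
Qed.

(** A maximal chain has to start at a wnode without exceptional element. The descent from [x] stops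
    because the ranks decrease. *)
Lemma descending_chain x m : wnode_of_rank G (Fin m) x ->
  exists (s : nat -> N) d, [/\ s d = x, elts G (s 0%N) = set0 &
    forall i, (i < d)%N -> [/\ exists n, wnode_of_rank G (Fin n) (s i),
      rank_lt (rk G (s i)) (rk G (s i.+1)) & elts G (s i.+1) (s i)]].
Proof.
elim: {m}m.+1 {-2}m (ltnSn m) x => // k IH m mk x [xG xm].
have [|/set0P[y xy]] := eqVneq (elts G x) set0.
  by exists (fun=> x), 0%N.
have yG := wg_elts hG xG xy; have ylt := wgraph_elts_lt xG xy.
have [p yp] : exists p, rk G y = Fin p.
  by move: ylt; rewrite xm; case: (rk G y) => // p; exists p.
have [|s [d [sd s0 sc]]] := IH p _ y (conj yG yp).
  by move: ylt; rewrite xm yp /rank_lt /=; lia.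
exists (fun i => if (i <= d)%N then s i else x), d.+1; rewrite ltnn; split => // i.
have [id _|di id] := ltnP i d; first by rewrite (ltnW id); exact: sc.
have -> : i = d by lia.
by rewrite leqnn sd; split => //; exists p.
Qed.

(** Otherwise every wnode embracing [x] has a natural-number rank, since from [Arrow] only a step to
    [Omega] is left and from there none. Climbing one element at a time then gives an infinite
    sequence, which extends downwards to a maximal chain, and the [Arrow]-wnode of this chain
    embraces [x]. *)
Lemma wgraph_maximal x : wnodes G x ->
  exists2 y, is_maximal_wnode G y & embraces G y x.
Proof.
move=> xG; have [[n rE]|rA] : (exists n, gr_rank G = Fin n) \/ rank_le Arrow (gr_rank G).
- by case: (gr_rank G) => [n||]; [left; exists n|right|right].
- by apply: (@bounded_maximal _ _ n) => // y /(wg_rank hG); rewrite rE.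
apply: contrapT => nm.
have next y : wnodes G y -> embraces G y x ->
    exists z, [/\ wnodes G z, embraces G z y & rank_lt (rk G y) (rk G z)].
  move=> yG yx; have : ~ is_maximal_wnode G y by move=> ym; apply: nm; exists y.
  rewrite /is_maximal_wnode => /not_andP[//|/existsNP[z]].
  by move=> /not_implyP[zG /not_implyP[zy /negP]]; rewrite negbK; exists z.
have fin y : wnodes G y -> embraces G y x -> exists m, rk G y = Fin m.
  move=> yG yx; have [z [zG zy yz]] := next y yG yx.
  case yr : (rk G y) yz => [m||]; [by exists m| |by case: (rk G z)].
  have [w [_ _]] := next z zG (embraces_trans zy yx).
  by case: (rk G z) => [m||] //; case: (rk G w).
have imm y : exists z, wnodes G y -> embraces G y x ->
    [/\ wnodes G z, elts G z y & embraces G z x].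
  have [[yG yx]|nyx] := pselect (wnodes G y /\ embraces G y x); last first.
    by exists y => yG yx; exfalso; apply: nyx.
  have [z [zG zy yz]] := next y yG yx.
  case: (embraces_last zy) => [zE|[c zc cy]]; first by move: yz; rewrite zE rank_ltxx.
  exists c => _ _; split => //; first exact: wgraph_embraces_wnodes zc.
  exact: embraces_elts yx.
have [f hf] := choice imm; pose t k := iter k f x.
have tP k : wnodes G (t k) /\ embraces G (t k) x.
  elim: k => [|k [h1 h2]]; first by split => //; exact: embraces_refl.
  by have [] := hf _ h1 h2.
have tS k : elts G (t k.+1) (t k) by have [] := hf _ (tP k).1 (tP k).2.
have [m xm] := fin x xG (embraces_refl G x).
have [s [d [sd s0 sc]]] := descending_chain (conj xG xm).
pose u i := if (i <= d)%N then s i else t (i - d)%N.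
have ut i : (d <= i)%N -> u i = t (i - d)%N.
  rewrite /u; case: ifP => // id di; have -> : i = d by lia.
  by rewrite sd subnn.
have us i : (i <= d)%N -> u i = s i by rewrite /u => ->.
have cu : chain_sequence u.
  split=> i; case: (ltnP i d) => id.
  - by rewrite us ?(ltnW id) //; have [] := sc i id.
  - rewrite ut //; have [h1 h2] := tP (i - d)%N; have [p hp] := fin _ h1 h2.
    by exists p.
  - by rewrite !us ?(ltnW id) //; have [] := sc i id.
  - rewrite !ut //; last exact: leqW.
    by rewrite subSn //; apply: wgraph_elts_lt => //; exact: (tP _).1.
  - by rewrite !us ?(ltnW id) //; have [] := sc i id.
  - by rewrite !ut //; [rewrite subSn|exact: leqW].
have mx : is_maximal_chain G (range u).
  split; first by apply/chain_sequenceE; exists u.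
  move=> c' /chain_sequenceE[s' cs' ->] sub.
  have [j _ jE] : range s' (u d) by apply: sub; exists d.
  apply/seteqP; split => //; apply: (chain_sequence_range cs' cu jE).
  (* A larger chain would extend below [s 0], which has no elements. *)
  rewrite leqNgt; apply/negP => dj.
  have [_ dn] := chain_sequence_align cu cs' (esym jE).
  have := dn d (leqnn _) (ltnW dj); rewrite subnn us // => sE.
  have [_ _ h] := cs'; have := h (j - d).-1.
  have -> : (j - d).-1.+1 = (j - d)%N by lia.
  by rewrite -sE s0.
have [a [[[aG aA] aE] _]] := wg_arrow_all hG rA mx.
have ax : embraces G a x.
  apply: embraces_elts (embraces_refl G x); rewrite aE; exists d => //.
  by rewrite us.
by have [p] := fin a aG ax; rewrite aA.
Qed.

Lemma wgraph_embracing_structure : embracing_structure G.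
Proof.
split.
- exact: wg_rank.
- exact: wg_elts.
- exact: wgraph_elts_lt.
- by move=> x y y' xG xA; apply: (wg_exceptional hG xG xA).2.
- move=> x t v xG xt tv; case E : (rank_pred (rk G x)) => [s|].
    have [_ h] := wg_tips hG xG E; have [w _ tE] := h t xt.
    by move: tv; rewrite tE => -[[_ _ ->]].
  case xr : (rk G x) E => [[|n]||] // _.
    by have [_ t0] := wg_0nodes hG (conj xG xr); rewrite t0 in xt.
  by have [t0 _] := wg_arrow hG (conj xG xr); rewrite t0 in xt.
- move=> x y y' x0; have [s cs ->] := arrow_chain x0; move=> [i _ <-] [j _ <-].
  have [ij|/ltnW ji] := leqP i j; [right|left]; exact: chain_sequence_embraces.
- by move=> x y z xG yG; apply: embraces_comparable.
- exact: wgraph_maximal.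
Qed.

(** * Wsections *)

Lemma wsubgraph_embraces n Bs x y : embraces (wsubgraph G (Fin n) Bs) x y ->
  embraces G x y.
Proof.
by elim=> [z|a b c [ab _] _]; [exact: embraces_refl|exact: embraces_elts].
Qed.

Lemma embraces_wsubgraph n Bs x y :
  wnodes (wsubgraph G (Fin n) Bs) x -> wnodes (wsubgraph G (Fin n) Bs) y ->
  embraces G x y -> embraces (wsubgraph G (Fin n) Bs) x y.
Proof.
move=> + + xy; elim: xy => [*|a b c ab bc IH aS cS]; first exact: embraces_refl.
have [aG ar _] := aS; have bG := wg_elts hG aG ab.
have bS : wnodes (wsubgraph G (Fin n) Bs) b.
  split => //; first by apply: rank_le_trans ar; case/andP: (wgraph_elts_lt aG ab).
  case: cS => _ _ [[z [e [cz Be ez]]]|[t [z cz zt] h]]; [left|right].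
    by exists z, e; split => //; apply: embraces_trans cz.
  by exists t => //; exists z => //; apply: embraces_trans cz.
by apply: embraces_elts (IH bS cS); split.
Qed.

Lemma wsubgraph_embracing_structure n Bs :
  embracing_structure (wsubgraph G (Fin n) Bs).
Proof.
have es := wgraph_embracing_structure; split.
- by move=> x [].
- by move=> x y _ [].
- by move=> x y [xG _ _] [xy _]; apply: es_lt xy.
- by move=> x y y' [xG _ _] xA [xy _] [xy' _]; apply: es_exceptional xy xy'.
- by move=> x t' v [xG _ _] [_ [t xt ->]] [tv _]; apply: es_tips xt tv.
- by move=> x y y' [[_ + _] xA]; rewrite /= in xA; rewrite xA.
- move=> x y z xS yS /wsubgraph_embraces xz /wsubgraph_embraces yz.
  have [xG _ _] := xS; have [yG _ _] := yS.
  by case: (es_comparable es xG yG xz yz) => h; [left|right]; apply: embraces_wsubgraph.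
- by move=> x xS; apply: (@bounded_maximal _ _ n) => // y [].
Qed.

End WgraphStructure.

(** A rank other than [Arrow] that is smaller than the rank of [G] is a natural number, so only
    wsubgraphs of such ranks occur besides [G] itself. *)
Lemma wsection_structure (N : Type) (G S : wgraph_data N) r :
  is_wgraph G -> wconnected G -> r <> Arrow -> is_wsection G r S ->
  [/\ embracing_structure S, wconnected S & gr_rank S = r].
Proof.
move=> hG cG rA [[-> ->]|[rG [Bs _ [-> cS _]]]].
  by split => //; exact: wgraph_embracing_structure.
split => //; case: r rA rG {cS} => [n||] rA rG; first exact: wsubgraph_embracing_structure.
  by case: rA.
by case: (gr_rank G) rG.
Qed.

(** * Wdistance *)

Section Distance.
Variables (N : Type) (S : wgraph_data N) (r : rank).
Hypotheses (es : embracing_structure S) (cS : wconnected S).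
Hypotheses (rS : gr_rank S = r) (rA : r <> Arrow).
Implicit Types (x y z : N) (u v w : pwalk N).

Let e := rank_expo r.

Lemma embraces_rank_lt x y : wnodes S x -> embraces S x y ->
  x = y \/ rank_lt (rk S y) (rk S x).
Proof.
move=> + xy; elim: xy => [*|a b c ab _ IH aS]; first by left.
have ba := es_lt es aS ab; right.
by case: (IH (es_elts es aS ab)) => [<- //|cb]; exact: rank_lt_trans ba.
Qed.

Lemma maximal_wnode_unique x y z : is_maximal_wnode S x -> is_maximal_wnode S y ->
  embraces S x z -> embraces S y z -> x = y.
Proof.
move=> [xS mx] [yS my] xz yz; case: (es_comparable es xS yS xz yz) => h.
  by case: (embraces_rank_lt xS h) => // l; have := my x xS h; rewrite l.
by case: (embraces_rank_lt yS h) => // l; have := mx y yS h; rewrite l.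
Qed.

Lemma walk_rank_le w : is_walk S w -> rank_le (wrank w) r.
Proof. by rewrite -rS; case: w => [a b x _|r' a b x W []] //=; case: (gr_rank S). Qed.

Lemma rank_expo_le s t : rank_le s t -> (rank_expo s <= rank_expo t)%O.
Proof. by case: s => [m||]; case: t => [n||] //= h; rewrite expo_mono. Qed.

Lemma joins_two_ended w x y : joins S w x y -> two_ended w.
Proof. by move=> [_ [l [h [wl wh _ _]]]]; split; rewrite ?wl ?wh. Qed.

Lemma joins_rev w x y : joins S w x y -> joins S (wrev w) y x.
Proof.
move=> [hw [l [h [wl wh xl yh]]]]; split; first exact: is_walk_rev.
exists (- h), (- l); rewrite wlo_rev whi_rev wl wh; split => //.
  by rewrite wnode_rev opprK.
by rewrite wnode_rev opprK.
Qed.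

Lemma candidate_bounded x y d : wdist_candidates S x y d -> bounded_by e d.
Proof.
move=> [x' [y' [_ _ [[_ ->]//|[w jw ->]]]]].
have [hw _] := jw; apply: bounded_by_trans ((wlength_bounded hw).2 (joins_two_ended jw)).
exact/rank_expo_le/walk_rank_le.
Qed.

(** Wconnectedness provides a candidate and [cnf_min] a least one, so the default value of [xget]
    does not occur. *)
Lemma wdist_spec x y : wnodes S x -> wnodes S y ->
  wdist_candidates S x y (wdist S x y) /\
  forall d, wdist_candidates S x y d -> (wdist S x y <= d)%O.
Proof.
move=> xS yS; apply: (xgetPex cnf0 (P := [set d | wdist_candidates S x y d /\
                     forall d', wdist_candidates S x y d' -> (d <= d')%O])).
have [x' mx xx'] := es_maximal es xS; have [y' my yy'] := es_maximal es yS.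
have [w jw] := cS mx.1 my.1.
have [|m Am mm] := @cnf_min (wdist_candidates S x y).
  by exists (wlength w), x', y'; split => //; right; exists w.
by exists m.
Qed.

(** The coefficient of omega^[r] in the wdistance.  As no wdistance in a wgraph
    of rank [r] reaches omega^[r] * omega, it measures galaxies. *)
Definition coarse_dist x y : nat := weight e (wdist S x y).

Lemma wdist_bounded x y : wnodes S x -> wnodes S y -> bounded_by e (wdist S x y).
Proof. by move=> xS yS; exact: candidate_bounded (wdist_spec xS yS).1. Qed.

Lemma coarse_dist_le x y d : wnodes S x -> wnodes S y ->
  wdist_candidates S x y d -> (coarse_dist x y <= weight e d)%N.
Proof.
move=> xS yS xyd; apply: weight_le; first exact: wdist_bounded.
  exact: candidate_bounded xyd.
exact: (wdist_spec xS yS).2.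
Qed.

Lemma coarse_dist_refl x : wnodes S x -> coarse_dist x x = 0%N.
Proof.
move=> xS; apply/eqP; rewrite -leqn0; have [x' mx xx'] := es_maximal es xS.
apply: (@coarse_dist_le x x cnf0) => //.
by exists x', x'; split => //; left.
Qed.

Lemma coarse_dist_sym x y : wnodes S x -> wnodes S y ->
  coarse_dist x y = coarse_dist y x.
Proof.
move=> xS yS; wlog suff : x y xS yS / (coarse_dist x y <= coarse_dist y x)%N.
  by move=> h; apply/eqP; rewrite eqn_leq !h.
have [[y' [x' [my mx h]]] _] := wdist_spec yS xS.
case: h => [[E d0]|[w jw dE]].
  apply: (@coarse_dist_le x y (wdist S y x)) => //.
  by exists x', y'; split => //; left.
have hw := jw.1; rewrite [X in (_ <= X)%N]/coarse_dist dE -(weight_rev e hw).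
apply: coarse_dist_le => //; exists x', y'; split => //; right.
by exists (wrev w) => //; exact: joins_rev.
Qed.

Lemma joins_raise s w x y : rank_pred r = Some s -> wnodes S x -> wnodes S y ->
  joins S w x y -> nontrivial w ->
  exists w', [/\ joins S w' x y, nontrivial w', wrank w' = r & wlength w' = wlength w].
Proof.
move=> rs xS yS jw nw; have [hw [l [h [wl wh xl yh]]]] := jw.
move: (walk_rank_le hw); rewrite (rank_pred_le _ rs) => -[ws|wr]; last by exists w.
have lw : link S s w x y.
  split => //; last by rewrite /reaches_right wh.
  by rewrite /reaches_left /reaches_right whi_rev wl /= wnode_rev opprK.
have rG : rank_le r (gr_rank S) by rewrite rS rank_le_refl.
have rk_le z : wnodes S z -> rank_le (rk S z) r by move=> /(es_rank es); rewrite rS.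
have [h1 h2] := one_link_walk rs rG xS (rk_le _ xS) yS (rk_le _ yS) lw.
exists (one_link r w x y); split => //; last exact: wlength_one_link.
by split => //; exists 0, 1; split => //; exact: embraces_refl.
Qed.

Lemma joins_trans u v x y z : wnodes S x -> wnodes S y -> wnodes S z ->
  joins S u x y -> joins S v y z -> nontrivial u -> nontrivial v ->
  exists2 w, joins S w x z &
    (weight e (wlength w) <= weight e (wlength u) + weight e (wlength v) + 2)%N.
Proof.
move=> xS yS zS; wlog ranked : u v / forall s, rank_pred r = Some s -> wrank u = r /\ wrank v = r.
  move=> wl ju jv nu nv; case rs : (rank_pred r) => [s|]; last by apply: wl => // s; rewrite rs.
  have [u' [u1 u2 u3 <-]] := joins_raise rs xS yS ju nu.
  have [v' [v1 v2 v3 <-]] := joins_raise rs yS zS jv nv.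
  by apply: wl.
move=> ju jv nu nv; have tu := joins_two_ended ju; have tv := joins_two_ended jv.
have [hu [l [h [ul uh xl yh]]]] := ju; have [hv [l' [h' [vl vh yl zh]]]] := jv.
suff [w [w1 w2 w3 w4]] : exists w, [/\ is_walk S w, same_left_end u w, same_right_end v w &
    (weight e (wlength w) <= weight e (wlength u) + weight e (wlength v) + 2)%N].
  exists w => //; split => //.
  have [l1 wl1 E1] := same_left_end_Some w2 ul; have [h1 wh1 E2] := same_right_end_Some w3 vh.
  by exists l1, h1; rewrite E1 E2.
have rk_le t : wnodes S t -> rank_le (rk S t) r by move=> /(es_rank es); rewrite rS.
case rs : (rank_pred r) => [s|].
  have [ur vr] := ranked s rs.
  have Cs : concatenates S s by apply: concatenates_pred rs => //; rewrite rS rank_le_refl.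
  have [w [w1 w2 w3 [w4 w5] w6]] :=
    concatenate_ranked es rs Cs hu nu ur uh hv nv vr vl yS (rk_le _ yS) yh yl.
  by exists w; split => //; exact: w6.
have r0 : r = Fin 0 by case: r rA rs => [[]||].
have eq0 t : rank_le t r -> t = Fin 0 by rewrite r0; case: t => [[|n]||].
have uy : reaches_right S u y by rewrite /reaches_right uh.
have vy : reaches_left S v y.
  by rewrite /reaches_left /reaches_right whi_rev vl /= wnode_rev opprK.
have [w [w1 w2 w3 [w4 w5] w6]] := concatenate_rank0 es hu nu (eq0 _ (walk_rank_le hu)) uy
  hv nv (eq0 _ (walk_rank_le hv)) vy (conj yS (eq0 _ (rk_le _ yS))).
by exists w; split => //; rewrite /e r0 w6 // leq_addr.
Qed.

(** The shortest walks end at maximal wnodes embracing [y], which coincide, so they can be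
    concatenated there. *)
Lemma coarse_dist_triangle x y z : wnodes S x -> wnodes S y -> wnodes S z ->
  (coarse_dist x z <= coarse_dist x y + coarse_dist y z + 2)%N.
Proof.
move=> xS yS zS.
have [[x' [y1 [[mx xx'] [my1 yy1] h1]]] _] := wdist_spec xS yS.
have [[y2 [z' [[my2 yy2] [mz zz'] h2]]] _] := wdist_spec yS zS.
have E := maximal_wnode_unique my1 my2 yy1 yy2; subst y2.
(* A trivial walk makes its two maximal wnodes embrace the same wnode, hence equal; such a walk can
   be left out. *)
have trivial_joins w a b : joins S w a b -> ~ nontrivial w ->
    is_maximal_wnode S a -> is_maximal_wnode S b -> a = b.
  move=> [hw [l [h [wl wh al bh]]]] nw ma mb; apply: maximal_wnode_unique ma mb al _.
  suff -> : l = h by [].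
  have lh := walk_ends hw wl wh; apply: contrapT => nlh; apply: nw; exists l.
  by rewrite /winside wl wh /inside; lia.
have left : x' = y1 -> (coarse_dist x z <= coarse_dist x y + coarse_dist y z + 2)%N.
  move=> E; subst y1; apply: (@leq_trans (coarse_dist y z)); last by lia.
  apply: (@coarse_dist_le x z (wdist S y z)) => //.
  by exists x', z'.
have right : y1 = z' -> (coarse_dist x z <= coarse_dist x y + coarse_dist y z + 2)%N.
  move=> E; subst y1; apply: (@leq_trans (coarse_dist x y)); last by lia.
  apply: (@coarse_dist_le x z (wdist S x y)) => //.
  by exists x', z'.
case: h1 => [[/left//]|[u ju du]]; case: h2 => [[/right//]|[v jv dv]].
have [nu|nu] := pselect (nontrivial u); last by apply: left; exact: trivial_joins ju nu _ _.
have [nv|nv] := pselect (nontrivial v); last by apply: right; exact: trivial_joins jv nv _ _.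
have [w jw ww] := joins_trans mx.1 my1.1 mz.1 ju jv nu nv.
apply: leq_trans (_ : (weight e (wlength w) <= _)%N); last first.
  by rewrite /coarse_dist du dv.
by apply: coarse_dist_le => //; exists x', z'; split => //; right; exists w.
Qed.

Lemma wdist_le_mono x y m : wnodes S x -> wnodes S y ->
  (wdist S x y <= cnf_mono e m)%O -> (coarse_dist x y <= m)%N.
Proof.
move=> xS yS /(weight_le (wdist_bounded xS yS) (bounded_by_mono m (lexx e))).
by rewrite weight_mono eqxx mul1n.
Qed.

(** Lower powers of omega may push the wdistance above omega^r * m, but not up to omega^r * (m + 1).
    The strict inequality in [coarse_dist_add_lt] has the same origin. *)
Lemma coarse_dist_mono x y m : wnodes S x -> wnodes S y ->
  (coarse_dist x y <= m)%N -> (wdist S x y <= cnf_mono e m.+1)%O.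
Proof.
move=> xS yS h; apply/ltW/(weight_lt (wdist_bounded xS yS) (bounded_by_mono _ (lexx e))).
by rewrite weight_mono eqxx mul1n ltnS.
Qed.

Lemma wdist_add_le x y x' y' m : wnodes S x -> wnodes S y -> wnodes S x' -> wnodes S y' ->
  (cnf_add (wdist S x y) (cnf_mono e m) <= wdist S x' y')%O ->
  (coarse_dist x y + m <= coarse_dist x' y')%N.
Proof.
move=> xS yS xS' yS' /(@weight_le e).
rewrite bounded_by_add !wdist_bounded // bounded_by_mono // => /(_ isT isT).
by rewrite weight_add weight_mono eqxx mul1n.
Qed.

Lemma coarse_dist_add_lt x y x' y' m :
  wnodes S x -> wnodes S y -> wnodes S x' -> wnodes S y' ->
  (coarse_dist x y + m < coarse_dist x' y')%N ->
  (cnf_add (wdist S x y) (cnf_mono e m) <= wdist S x' y')%O.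
Proof.
move=> xS yS xS' yS' h; apply/ltW/(@weight_lt e).
- by rewrite bounded_by_add wdist_bounded // bounded_by_mono.
- exact: wdist_bounded.
by rewrite weight_add weight_mono eqxx mul1n.
Qed.

End Distance.

(** * Galaxies *)

Section Galaxies.
Variables (N : Type) (F : set_system nat) (S : wgraph_data N) (r : rank).
Hypothesis pF : ProperFilter F.
Hypotheses (es : embracing_structure S) (cS : wconnected S).
Hypotheses (rS : gr_rank S = r) (rA : r <> Arrow).
Implicit Types (x y z : nat -> N) (X Y Z : set (nat -> N)).

Let D := coarse_dist S r.

Let D_sym := coarse_dist_sym es cS rS.
Let D_triangle := coarse_dist_triangle es cS rS rA.

Lemma filter_and (P Q : nat -> Prop) :
  F [set n | P n] -> F [set n | Q n] -> F [set n | P n /\ Q n].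
Proof. exact: filterI. Qed.

Lemma filter_imp (P Q : nat -> Prop) :
  (forall n, P n -> Q n) -> F [set n | P n] -> F [set n | Q n].
Proof. by move=> PQ; apply: filterS. Qed.

Definition wnode_sequence x : Prop := forall n, wnodes S (x n).

Definition bounded_dist x y : Prop := exists c, F [set n | (D (x n) (y n) <= c)%N].

Lemma bounded_dist_sym x y : wnode_sequence x -> wnode_sequence y ->
  bounded_dist x y -> bounded_dist y x.
Proof.
by move=> xS yS [c h]; exists c; apply: filter_imp h => n; rewrite /D D_sym.
Qed.

Lemma bounded_dist_trans x y z : wnode_sequence x -> wnode_sequence y ->
  wnode_sequence z -> bounded_dist x y -> bounded_dist y z -> bounded_dist x z.
Proof.
move=> xS yS zS [c h] [c' h']; exists (c + c' + 2)%N.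
apply: filter_imp (filter_and h h') => n [h1 h2].
by have := D_triangle (xS n) (yS n) (zS n); rewrite /D in h1 h2 *; lia.
Qed.

Lemma bounded_dist_eq x y : wnode_sequence x ->
  F [set n | x n = y n] -> bounded_dist x y.
Proof.
move=> xS h; exists 0%N; apply: filter_imp h => n <-.
by rewrite /D (coarse_dist_refl es cS rS (xS n)).
Qed.

Lemma hypernode_rep X x : hypernode F S X -> X x -> wnode_sequence x.
Proof. by move=> [a _ [y _ ->]] [h _] n; have [] := h n. Qed.

Lemma hypernode_rep_eq X x y : hypernode F S X -> X x -> X y -> F [set n | x n = y n].
Proof.
move=> [a _ [z _ ->]] [_ hx] [_ hy].
by apply: filter_imp (filter_and hx hy) => n [-> ->].
Qed.

Lemma hypernode_nonempty X : hypernode F S X -> X !=set0.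
Proof.
move=> [a _ [x h ->]]; exists x; split => //.
by apply: filter_imp filterT.
Qed.

(** Two representatives of a hypernode agree on a set in [F], so the representatives whose existence
    the definition asserts can be exchanged for any given ones. *)
Lemma limitedly_distantP X Y x y : hypernode F S X -> hypernode F S Y -> X x -> Y y ->
  limitedly_distant F S r X Y <-> bounded_dist x y.
Proof.
move=> hX hY Xx Yy; have xS := hypernode_rep hX Xx; have yS := hypernode_rep hY Yy.
split => [[x' [y' [Xx' Yy' [m h]]]]|[m h]]; last first.
  exists x, y; split => //; exists m.+1; apply: filter_imp h => n.
  exact: (coarse_dist_mono es cS rS (xS n) (yS n)).
have xS' := hypernode_rep hX Xx'; have yS' := hypernode_rep hY Yy'.
apply: (@bounded_dist_trans _ x') => //.
  exact/bounded_dist_eq/(hypernode_rep_eq hX).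
apply: (@bounded_dist_trans _ y') => //.
  exists m; apply: filter_imp h => n; exact: (wdist_le_mono es cS rS (xS' n) (yS' n)).
exact/bounded_dist_eq/(hypernode_rep_eq hY).
Qed.

Lemma galaxy_bounded A Y Y' y y' : is_galaxy F S r A ->
  gal_hypernodes A Y -> gal_hypernodes A Y' -> Y y -> Y' y' ->
  [/\ wnode_sequence y, wnode_sequence y' & bounded_dist y y'].
Proof.
move=> [_ [X hX ->] ->] /= [hY YX] [hY' YX'] Yy Yy'.
have [x Xx] := hypernode_nonempty hX; have xS := hypernode_rep hX Xx.
have yS := hypernode_rep hY Yy; have yS' := hypernode_rep hY' Yy'.
split => //; apply: (@bounded_dist_trans _ x) => //.
  exact/(limitedly_distantP hY hX Yy Xx).
by apply: bounded_dist_sym => //; apply/(limitedly_distantP hY' hX Yy' Xx).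
Qed.

Lemma standard_hypernode_hypernode Z : standard_hypernode F S Z -> hypernode F S Z.
Proof. by move=> [a [v [aS vS ->]]]; exists a => //; exists (fun=> v). Qed.

(** Standard hypernodes are limitedly distant because the wdistance between
    two fixed wnodes is one ordinal below omega^[r] * omega. *)
Lemma principal_bounded X X' x x' :
  gal_hypernodes (principal_galaxy F S r) X -> gal_hypernodes (principal_galaxy F S r) X' ->
  X x -> X' x' -> [/\ wnode_sequence x, wnode_sequence x' & bounded_dist x x'].
Proof.
move=> [hX [Z sZ XZ]] [hX' [Z' sZ' XZ']] Xx Xx'.
have hZ := standard_hypernode_hypernode sZ; have hZ' := standard_hypernode_hypernode sZ'.
have xS := hypernode_rep hX Xx; have xS' := hypernode_rep hX' Xx'.
have cst a v : wnode_of_rank S a v -> hclass F S a (fun=> v) (fun=> v).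
  by move=> va; split => //; apply: filter_imp filterT.
have [a [v [_ va ZE]]] := sZ; have [a' [v' [_ va' ZE']]] := sZ'.
have Zv : Z (fun=> v) by rewrite ZE; exact: cst.
have Zv' : Z' (fun=> v') by rewrite ZE'; exact: cst.
have vS : wnode_sequence (fun=> v) by move=> n; exact: va.1.
have vS' : wnode_sequence (fun=> v') by move=> n; exact: va'.1.
split => //; apply: (@bounded_dist_trans _ (fun=> v)) => //.
  exact/(limitedly_distantP hX hZ Xx Zv).
apply: (@bounded_dist_trans _ (fun=> v')) => //.
  by exists (D v v'); apply: filter_imp filterT.
by apply: bounded_dist_sym => //; apply/(limitedly_distantP hX' hZ' Xx' Zv').
Qed.

Lemma galaxy_hypernode A Y : is_galaxy F S r A -> gal_hypernodes A Y -> hypernode F S Y.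
Proof. by move=> [_ [X _ ->] ->] []. Qed.

Lemma closer_coarse A B : is_galaxy F S r A -> is_galaxy F S r B -> closer F S r A B ->
  exists X Y Z, exists x y z : nat -> N,
    [/\ gal_hypernodes (principal_galaxy F S r) X /\ X x,
        gal_hypernodes A Y /\ Y y, gal_hypernodes B Z /\ Z z &
        forall m, F [set n | (D (y n) (x n) + m <= D (z n) (x n))%N]].
Proof.
move=> gA gB [X [Y [Z [x [y [z [[pX Xx] [aY Yy] [bZ Zz] h]]]]]]].
exists X, Y, Z, x, y, z; split => // m; apply: filter_imp (h m) => n.
have [xS _ _] := principal_bounded pX pX Xx Xx.
have yS := hypernode_rep (galaxy_hypernode gA aY) Yy.
have zS := hypernode_rep (galaxy_hypernode gB bZ) Zz.
exact: (wdist_add_le es cS rS (yS n) (xS n) (zS n) (xS n)).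
Qed.

Lemma closer_asym A B : is_galaxy F S r A -> is_galaxy F S r B ->
  closer F S r A B -> ~ closer F S r B A.
Proof.
move=> gA gB /(closer_coarse gA gB) [X [Y [Z [x [y [z [[pX Xx] [aY Yy] [bZ Zz] h]]]]]]].
move=> /(closer_coarse gB gA) [X' [Z' [Y' [x' [z' [y' [[pX' Xx'] [bZ' Zz'] [aY' Yy'] h']]]]]]].
have [xS xS' [c cx]] := principal_bounded pX pX' Xx Xx'.
have [yS yS' [c1 cy]] := galaxy_bounded gA aY aY' Yy Yy'.
have [zS zS' [c2 cz]] := galaxy_bounded gB bZ bZ' Zz Zz'.
(* Chaining both hypotheses gives [2 * m <= c + c + c1 + c2 + 8], where 8 is the error of four
   triangle inequalities. *)
pose m := (c + c + c1 + c2 + 9)%N.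
have /filter_ex [n [[n1 n2] [[n3 n4] n5]]] :=
  filter_and (filter_and (h m) (h' m)) (filter_and (filter_and cx cy) cz).
have t1 := D_triangle (zS n) (zS' n) (xS n).
have t2 := D_triangle (zS' n) (xS' n) (xS n).
have t3 := D_triangle (yS' n) (yS n) (xS' n).
have t4 := D_triangle (yS n) (xS n) (xS' n).
rewrite (D_sym (xS' n) (xS n)) in t2; rewrite (D_sym (yS' n) (yS n)) in t3.
by rewrite /m /D in n1 n2 n3 n4 n5; lia.
Qed.

Lemma closer_trans A B C : is_galaxy F S r A -> is_galaxy F S r B -> is_galaxy F S r C ->
  closer F S r A B -> closer F S r B C -> closer F S r A C.
Proof.
move=> gA gB gC.
move=> /(closer_coarse gA gB) [X [Y [Z [x [y [z [[pX Xx] [aY Yy] [bZ Zz] h]]]]]]].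
move=> /(closer_coarse gB gC) [X' [Z' [V [x' [z' [v [[pX' Xx'] [bZ' Zz'] [cV Vv] h']]]]]]].
have [xS xS' [c cx]] := principal_bounded pX pX' Xx Xx'.
have [zS zS' [c2 cz]] := galaxy_bounded gB bZ bZ' Zz Zz'.
have yS := hypernode_rep (galaxy_hypernode gA aY) Yy.
have vS := hypernode_rep (galaxy_hypernode gC cV) Vv.
exists X, Y, V, x, y, v; split => // m.
(* The gap comes from the second hypothesis alone. Changing representatives costs [c + c + c2] and
   three errors of 2; the strict inequality needed below takes 1 more. *)
apply: filter_imp (filter_and (filter_and (h 0%N) (h' (m + c + c + c2 + 9)%N)) (filter_and cx cz)).
move=> n [[n1 n2] [n3 n4]].
apply: (coarse_dist_add_lt es cS rS (yS n) (xS n) (vS n) (xS n)).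
have t1 := D_triangle (zS n) (zS' n) (xS n).
have t2 := D_triangle (zS' n) (xS' n) (xS n).
have t3 := D_triangle (vS n) (xS n) (xS' n).
rewrite (D_sym (xS' n) (xS n)) in t2.
by rewrite /D in n1 n2 n3 n4; lia.
Qed.

End Galaxies.

Unset Implicit Arguments.

Theorem theorem5p2 (N : Type) (F : set_system nat) (nu rho : rank)
    (G S : wgraph_data N) (hF : free_ultrafilter F)
    (hG : is_wgraph G) (hnu : gr_rank G = nu) (hGconn : wconnected G)
    (hnu2 : rank_le (Fin 2) nu)
    (hrho : rank_le rho nu) (hrho_arrow : rho <> Arrow)
    (hS : is_wsection G rho S)
    (hX : exists2 X, hypernode F S X
                   & ~ gal_hypernodes (principal_galaxy F S rho) X) :
  partially_orders (is_galaxy F S rho)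
    (fun A B : galaxy N => A = B \/ closer F S rho A B).
Proof.
have [es cS rS] := wsection_structure hG hGconn hrho_arrow hS.
have pF : ProperFilter F by case: hF => [[]].
split.
- by left.
(* Antisymmetry holds because two galaxies are never closer than each other. *)
- move=> A B gA gB [//|AB] [//|BA].
  by case: (closer_asym pF es cS rS hrho_arrow gA gB AB BA).
move=> A B C gA gB gC [->//|AB] [<-|BC]; first by right.
right; exact: (closer_trans pF es cS rS hrho_arrow gA gB gC AB BC).
Qed.
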